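(* Let $X,Y$ be real Banach spaces, $G\subset X$ a nonempty open set, and $f:G\to Y$ a Lipschitz mapping which is Fréchet differentiable at $\Gamma$-almost every point of $G$ (i.e. the set of points of $G$ at which $f$ is not Fréchet differentiable is $\Gamma$-null). Let $\Upsilon=\{D_f(x): x\in G,\ f\text{ is Gâteaux differentiable at }x\}$ be the set of Gâteaux derivatives of $f$. Then for every slice $S$ of $\Upsilon$, the set of points $x\in G$ at which $f$ is Fréchet differentiable and $D_f(x)\in S$ is not $\Gamma$-null.
   Context: $f$ is Gâteaux differentiable at $x$ if there is a bounded linear operator $D_f(x):X\to Y$ with $\lim_{t\to0}(f(x+tu)-f(x))/t=D_f(x)u$ for every $u\in X$; it is Fréchet differentiable at $x$ if moreover $f(x+u)=f(x)+D_f(x)u+o(\|u\|)$ as $\|u\|\to0$. A slice of a set $\Upsilon$ of bounded linear operators from $X$ to $Y$ is a set of the form $$S(\Upsilon,\{v_i\}_{i=1}^m,\{y_i^\star\}_{i=1}^m,\delta)=\Big\{L\in\Upsilon:\ \sum_{i=1}^m y_i^\star(Lv_i)>\alpha-\delta\Big\},\qquad \alpha=\sup_{L\in\Upsilon}\sum_{i=1}^m y_i^\star(Lv_i),$$ where $m\in\mathbb{N}$, $v_1,\dots,v_m\in X$, $y_1^\star,\dots,y_m^\star\in Y^\star$ and $\delta>0$. $\Gamma$-null sets. $T=[0,1]^{\mathbb{N}}$ carries the product topology and the product Lebesgue (probability) measure $\mu$. $\Gamma(X)$ is the space of continuous maps $\gamma:T\to X$ having continuous partial derivatives $D_j\gamma:T\to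 X$ for all $j\in\mathbb{N}$ (one-sided where the $j$-th coordinate is $0$ or $1$), with the topology generated by the seminorms $\|\gamma\|_0=\sup_{t\in T}\|\gamma(t)\|$ and $\|\gamma\|_k=\sup_{t\in T}\|D_k\gamma(t)\|$, $k\ge1$. A Borel set $N\subset X$ is $\Gamma$-null if $\mu\{t\in T:\gamma(t)\in N\}=0$ for all $\gamma$ in a residual (comeager) subset of $\Gamma(X)$. An arbitrary set is $\Gamma$-null if it is contained in a Borel $\Gamma$-null set. *)

(* Defs.v *)
From HB Require Import structures.
From mathcomp Require Import all_boot all_order all_algebra.
From mathcomp Require Import all_classical all_reals all_analysis.
From mathcomp Require Import borel_hierarchy.

Set Implicit Arguments.
Unset Strict Implicit.
Unset Printing Implicit Defensive.

Import Order.TTheory GRing.Theory Num.Theory.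
Import numFieldNormedType.Exports.

Local Open Scope classical_set_scope.
Local Open Scope ring_scope.

(* MathComp-Analysis over an arbitrary [R : realType]; Banach spaces are
   [completeNormedModType R]. *)

(* [0, 1] with the subtype topology: limits along its punctured neighbourhoods
   are one-sided at the end points. *)
Notation unit_interval R := (set_type (`[0, 1] : set R)).

(* The cube T = [0, 1]^nat with the product topology. *)
Notation cube R := (prod_topology (fun _ : nat => unit_interval R)).

Section product_lebesgue.
Context {R : realType}.
Implicit Types (n : nat) (E : nat -> set R).

Definition cylinder n E : set (cube R) :=
  [set t | forall j, (j < n)%N -> E j (\val (t j))].

Definition cylinder_volume n E : \bar R :=
  (\prod_(j < n) lebesgue_measure (E j `&` `[0%R, 1%R]))%E.

(* The Caratheodory construction of the product of the Lebesgue measures on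
   [0, 1]: the outer measure generated by the volume of measurable cylinders.
   On the Borel subsets of the cube it is the product measure; it is only used
   below on preimages of Borel sets under continuous maps. *)
Definition product_lebesgue (A : set (cube R)) : \bar R :=
  ereal_inf [set y | exists (n : nat -> nat) (E : nat -> nat -> set R),
    [/\ forall k j, measurable (E k j),
        A `<=` \bigcup_k cylinder (n k) (E k) &
        y = (\sum_(0 <= k <oo) cylinder_volume (n k) (E k))%E]].

End product_lebesgue.

Section gamma_space.
Context {R : realType} {X : normedModType R}.
Implicit Types (g : cube R -> X) (t : cube R) (j k : nat).

Definition partial_quotient j g t (s : unit_interval R) : X :=
  (\val s - \val (t j))^-1 *: (g (dfwith t j s) - g t).

Definition partial_derivable j g t : Prop :=
  cvg (partial_quotient j g t s @[s --> (t j)^']).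

Definition partial_derive j g t : X :=
  lim (partial_quotient j g t s @[s --> (t j)^']).

Definition C1_surface : set (cube R -> X) :=
  [set g | continuous g /\
    forall j, (forall t, partial_derivable j g t) /\
              continuous (partial_derive j g)].

(* Coordinates are numbered from 0, so that the seminorm of index j.+1 is the
   one of the j-th partial derivative. *)
Definition gamma_seminorm k g : R :=
  sup (range (fun t => `|if k is j.+1 then partial_derive j g t else g t|)).

End gamma_space.

Definition gamma_space (R : realType) (X : normedModType R) : Type :=
  set_type (@C1_surface R X).

Section gamma_topology.
Context {R : realType} {X : normedModType R}.
Local Notation Gamma := (gamma_space X).

Definition gamma_fun (g : Gamma) : cube R -> X := \val g.

(* Open sets of the topology generated by the seminorms. *)
Definition gamma_open : set_system Gamma :=
  [set U | forall g, U g -> exists (n : nat) (e : R), 0 < e /\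
    forall h : Gamma, (forall k, (k <= n)%N ->
      gamma_seminorm k (gamma_fun h \- gamma_fun g) < e) -> U h].

Lemma gamma_openT : gamma_open setT.
Proof. by move=> g _; exists 0%N, 1. Qed.

Lemma gamma_openI : setI_closed gamma_open.
Proof.
move=> U V oU oV g [Ug Vg].
have [n [e [e0 Ue]]] := oU g Ug; have [m [d [d0 Vd]]] := oV g Vg.
exists (maxn n m), (Num.min e d); split; first by rewrite lt_min e0.
move=> h gh; split; [apply: Ue|apply: Vd] => k kle.
  have /gh := leq_trans kle (leq_maxl n m).
  by rewrite lt_min => /andP[].
have /gh := leq_trans kle (leq_maxr n m).
by rewrite lt_min => /andP[].
Qed.

Lemma gamma_open_bigU (I : Type) (U : I -> set Gamma) :
  (forall i, gamma_open (U i)) -> gamma_open (\bigcup_i U i).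
Proof.
move=> oU g [i _ /(oU i)[n [e [e0 Ue]]]]; exists n, e; split=> // h gh.
by exists i => //; exact: Ue.
Qed.

HB.instance Definition _ := gen_eqMixin Gamma.
HB.instance Definition _ := gen_choiceMixin Gamma.
HB.instance Definition _ :=
  isOpenTopological.Build Gamma gamma_openT gamma_openI gamma_open_bigU.

End gamma_topology.

Definition residual {T : topologicalType} (A : set T) : Prop :=
  exists2 S : set T, Gdelta_dense S & S `<=` A.

Definition borel_set {T : topologicalType} (A : set T) : Prop :=
  <<s [set U : set T | open U] >> A.

Section gamma_null.
Context {R : realType} {X : normedModType R}.

Definition borel_gamma_null (N : set X) : Prop :=
  borel_set N /\
  residual [set g : gamma_space X |
    product_lebesgue (gamma_fun g @^-1` N) = 0%E].

Definition gamma_null (A : set X) : Prop :=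
  exists2 N : set X, borel_gamma_null N & A `<=` N.

End gamma_null.

Section derivatives.
Context {R : realType} {X Y : normedModType R}.

(* [L] is the Gateaux derivative of [f] at [x].  A linear map is bounded if and
   only if it is continuous, see [linear_bounded_continuous]. *)
Definition is_gateaux_derivative (f : X -> Y) (x : X) (L : {linear X -> Y}) :=
  continuous L /\ forall u, is_derive x u f (L u).

Definition gateaux_derivatives (G : set X) (f : X -> Y) :
    set {linear X -> Y} :=
  [set L | exists2 x, G x & is_gateaux_derivative f x L].

Definition slice (Ups : set {linear X -> Y}) (m : nat) (v : 'I_m -> X)
    (ystar : 'I_m -> {linear Y -> R^o}) (delta : R) : set {linear X -> Y} :=
  let pairing (L : {linear X -> Y}) : R := \sum_(i < m) ystar i (L (v i)) in
  let alpha := sup [set pairing L | L in Ups] in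
  [set L | Ups L /\ pairing L > alpha - delta].

End derivatives.

(* Main.v *)
(* Take a Gateaux derivative [L = D_f(x0)] whose pairing nearly attains the
   supremum, and the small affine surface
   [t |-> x0 + r \sum_i (t_i - 1/2) v_i].  Since [Gamma(X)] is a Baire space,
   there is a surface [g], close to it together with its first [m] partial
   derivatives, such that [g(t)] avoids any two prescribed Gamma-null sets for
   almost every [t].  The average over [T] of [\sum_i d/dt_i (y_i o f o g)]
   depends only on the values of [f o g] on the faces [t_i = 0, 1], and there
   [f o g] is uniformly close to the affine map given by [L]; hence this average
   is at least [r] times the pairing of [L], up to a small error.  If the points
   of the slice formed a Gamma-null set, the integrand would be at most [r]
   times [alpha - delta], up to a small error, almost everywhere.

   No integral on the infinite cube is needed: the coordinates of a good point
   [t] are chosen one at a time, first the tail (keeping the volume of a cover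
   of the exceptional set small) and then the first [m] coordinates (keeping
   moreover the limit inferior of averaged difference quotients under control,
   by Fatou's lemma). *)

Require Import Defs.
From HB Require Import structures.
From mathcomp Require Import all_boot all_order all_algebra.
From mathcomp Require Import all_classical all_reals all_analysis.
From mathcomp Require Import measurable_realfun.
From mathcomp Require Import ring lra.

Import Order.TTheory GRing.Theory Num.Theory.
Import numFieldNormedType.Exports.

Local Open Scope classical_set_scope.
Local Open Scope ring_scope.

Set Implicit Arguments.
Unset Strict Implicit.
Unset Printing Implicit Defensive.

(** * Averaging over coordinates *)

Section averaging.
Context {R : realType}.
Local Notation mu := (@lebesgue_measure R).
Local Notation D := (`[0%R, 1%R[%classic : set R).
Local Notation point := (nat -> R).

(** The set to be avoided is known only through covers by cylinders of small total volume, and a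
    single choice of coordinates must both escape such a cover and keep a lower limit of averages
    small. Both quantities decrease on average as coordinates get fixed, and so does every
    nonnegative combination of them; one potential with a heavily weighted volume therefore serves
    both demands. Functions on the cube are carried over to [nat -> R] by clamping each coordinate
    to [0, 1], so that shifted points always make sense. The points selected have coordinates in the
    half-open interval [D]: forward difference quotients at them eventually involve no clamping and
    see the surface itself. The two null sets are the non-differentiability set, off which the
    quotients converge to a value of the Frechet derivative, and the set of slice points, supposed
    null for contradiction. *)

Definition update (t : point) (j : nat) (s : R) : point :=
  fun i => if i == j then s else t i.

Lemma update_same t j s : update t j s j = s.
Proof. by rewrite /update eqxx. Qed.

Lemma update_neq t j s i : i != j -> update t j s i = t i.
Proof. by rewrite /update => /negbTE ->. Qed.

Lemma update_id t j : update t j (t j) = t.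
Proof. by apply/funext => i; rewrite /update; case: eqP => // ->. Qed.

Lemma update_update t j s s' : update (update t j s) j s' = update t j s'.
Proof. by apply/funext => i; rewrite /update; case: eqP. Qed.

Lemma updateC t i j s s' : i != j ->
  update (update t i s) j s' = update (update t j s') i s.
Proof.
move=> ij; apply/funext => k; rewrite /update.
by case: (eqVneq k j) => // ->; rewrite eq_sym (negbTE ij).
Qed.

Lemma mu_unit : mu D = 1%E.
Proof. by rewrite lebesgue_measure_itv/= lte_fin ltr01 oppr0 adde0. Qed.

(** Since [D] has measure one, an [f] exceeding its integral [c] on all of [D] would make [f - c]
    positive with zero integral. Here [c] is finite because it lies strictly below [f 0]. *)
Lemma exists_le_integral (f : R -> \bar R) :
  (forall s, (0 <= f s)%E) -> measurable_fun [set: R] f ->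
  exists2 s, D s & (f s <= \int[mu]_(x in D) f x)%E.
Proof.
move=> f0 mfT; apply: contrapT => /forall2NP h.
have mf : measurable_fun D f by exact: measurable_funTS.
have mD : measurable D by exact: measurable_itv.
have {}h s : D s -> (\int[mu]_(x in D) f x < f s)%E.
  by move=> Ds; case: (h s) => // /negP; rewrite -ltNge.
have J0 : (0 <= \int[mu]_(x in D) f x)%E by exact: integral_ge0.
have Jy : (\int[mu]_(x in D) f x < +oo)%E.
  apply: (@lt_le_trans _ _ (f 0)); last exact: leey.
  by apply: h => /=; rewrite in_itv/= lexx ltr01.
have Jfin : (\int[mu]_(x in D) f x)%E \is a fin_num by rewrite ge0_fin_numE.
set c := fine (\int[mu]_(x in D) f x)%E.
have JE : (\int[mu]_(x in D) f x)%E = c%:E by rewrite fineK.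
have c0 : 0 <= c by exact: fine_ge0.
pose g x := (f x - c%:E)%E.
have g0 x : D x -> (0 < g x)%E.
  by move=> Dx; rewrite /g sube_gt0 -JE; exact: h.
have mg : measurable_fun D g by apply: emeasurable_funB.
have fE x : f x = (g x + c%:E)%E by rewrite /g subeK.
have : (\int[mu]_(x in D) `|g x| = 0)%E.
  transitivity (\int[mu]_(x in D) g x)%E.
    apply: eq_integral => x; rewrite inE => Dx.
    by rewrite gee0_abs// ltW// g0.
  have := JE; under eq_integral do rewrite fE.
  rewrite ge0_integralD//=; last by move=> x Dx; exact/ltW/g0.
  rewrite integral_cst//= mu_unit mule1 => /(congr1 (fun x => x - c%:E)%E).
  by rewrite /= addeK// subee// => ->.
move/(ae_eq_integral_abs mu mD mg) => [N [mN N0 sN]].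
have : (mu D <= mu N)%E.
  apply: le_measure; rewrite ?inE//; apply: subset_trans sN => x Dx /= /(_ Dx).
  by move=> gx0; have := g0 x Dx; rewrite gx0 ltxx.
by rewrite N0; rewrite mu_unit lee_fin ler10.
Qed.

(* The average over the coordinates below [m] of a nonnegative function of all
   coordinates; superharmonicity is what is needed to choose these coordinates
   one after the other without increasing the average. *)
Definition potential (W : nat -> point -> \bar R) := forall m t,
  [/\ (0 <= W m t)%E, measurable_fun [set: R] (fun s => W m (update t m s)) &
      (\int[mu]_(s in D) W m (update t m s) <= W m.+1 t)%E].

Lemma potentialD W1 W2 : potential W1 -> potential W2 ->
  potential (fun m t => W1 m t + W2 m t)%E.
Proof.
move=> h1 h2 m t; have [p1 m1 i1] := h1 m t; have [p2 m2 i2] := h2 m t.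
split; [exact: adde_ge0|exact: emeasurable_funD|].
rewrite ge0_integralD//; first exact: leeD.
- by move=> s _; have [] := h1 m (update t m s).
- exact: measurable_funTS.
- by move=> s _; have [] := h2 m (update t m s).
- exact: measurable_funTS.
Qed.

Lemma potentialZ (k : R) W : 0 <= k -> potential W ->
  potential (fun m t => k%:E * W m t)%E.
Proof.
move=> k0 h m t; have [p1 m1 i1] := h m t.
split; [exact: mule_ge0|exact: measurable_funeM|].
rewrite ge0_integralZl//; first exact: lee_wpmul2l.
- exact: measurable_funTS.
- by move=> s _; have [] := h m (update t m s).
Qed.

(** The coordinates are fixed downwards, from [m.-1] to [0], each at a value where the potential
    does not exceed its average; the tail of [t] is never touched. *)
Lemma potential_select W m t : potential W -> exists u,
  [/\ forall j, (j < m)%N -> D (u j), forall j, (m <= j)%N -> u j = t j &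
      (W 0%N u <= W m t)%E].
Proof.
move=> hW; elim: m t => [|m IH] t; first by exists t.
have [s Ds sle] := exists_le_integral
  (fun s => let: And3 p _ _ := hW m (update t m s) in p)
  (let: And3 _ q _ := hW m t in q).
have [u [uD ut uW]] := IH (update t m s); exists u; split.
- move=> j; rewrite ltnS leq_eqVlt => /predU1P[->|/uD//].
  by rewrite ut// update_same.
- by move=> j mj; rewrite ut 1?ltnW// update_neq// gtn_eqF.
- by apply: (le_trans uW); apply: (le_trans sle); have [] := hW m t.
Qed.

End averaging.

(** * Iterated averages of separately Lipschitz functions *)

Section iterated_integral.
Context {R : realType}.
Local Notation mu := (@lebesgue_measure R).
Local Notation D := (`[0%R, 1%R[%classic : set R).
Local Notation point := (nat -> R).
Implicit Types (F : point -> R) (t : point) (M : R) (K : nat -> R).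

(** A class stable under averaging with the same constants: its one-variable sections are bounded
    and continuous, hence integrable on [D]. The Lipschitz constant may depend on the coordinate. *)
Definition regular M K F :=
  (forall t, `|F t| <= M) /\
  forall j t s s', `|F (update t j s) - F (update t j s')| <= K j * `|s - s'|.

Lemma lipschitz_continuous_fun (k : R) (g : R -> R) :
  (forall s s', `|g s - g s'| <= k * `|s - s'|) -> continuous g.
Proof.
move=> gk x; apply/cvgrPdist_le => e e0; have [k0|k0] := leP k 0.
  apply: nearW => y; apply: (le_trans (gk x y)).
  by rewrite (le_trans _ (ltW e0))// mulr_le0_ge0.
near=> y; apply: (le_trans (gk x y)).
rewrite mulrC -ler_pdivlMr//; near: y.
by apply: cvgr_dist_le; [exact: cvg_id|exact: divr_gt0].
Unshelve. all: by end_near. Qed.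

Lemma regular_continuous M K F t j :
  regular M K F -> continuous (fun s => F (update t j s)).
Proof. by move=> [_ FK]; apply: (@lipschitz_continuous_fun (K j)) => s s'. Qed.

Lemma continuous_bounded_integrable M (g : R -> R) :
  continuous g -> (forall s, `|g s| <= M) -> mu.-integrable D (EFin \o g).
Proof.
move=> cg gM; apply: (@le_integrable _ _ _ mu D _ _ (cst M%:E)) => //=.
- apply/measurable_EFinP; apply: measurable_funTS.
  exact: continuous_measurable_fun.
- by move=> s _; rewrite lee_fin (le_trans (gM s))// ler_norm.
- apply/integrableP; split; first exact: measurable_cst.
  under eq_integral do rewrite /=.
  by rewrite integral_cst//= mu_unit mule1 ltry.
Qed.

Lemma regular_integrable M K F t j : regular M K F ->
  mu.-integrable D (EFin \o (fun s => F (update t j s))).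
Proof.
move=> FMK; apply: (@continuous_bounded_integrable M).
  exact: regular_continuous FMK.
by move=> s; apply FMK.
Qed.

Lemma cst_integrable (c : R) : mu.-integrable D (EFin \o (fun=> c)).
Proof.
apply: (@continuous_bounded_integrable `|c|) => //.
by move=> x; exact: cvg_cst.
Qed.

Lemma Rintegral_unit_cst (c : R) : \int[mu]_(s in D) c = c.
Proof. by rewrite Rintegral_cst//= mu_unit mulr1. Qed.

Lemma le_norm_Rintegral_unit M (g : R -> R) :
  mu.-integrable D (EFin \o g) -> (forall s, `|g s| <= M) ->
  `|\int[mu]_(s in D) g s| <= M.
Proof.
move=> ig gM; rewrite (le_trans (le_normr_Rintegral _ _))//.
rewrite -[leRHS](Rintegral_unit_cst M); apply: le_Rintegral => //.
- exact: (integrable_norm ig).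
- exact: cst_integrable.
Qed.

Definition average j F t : R := \int[mu]_(s in D) F (update t j s).

Lemma average_regular j M K F : (forall i, 0 <= K i) ->
  regular M K F -> regular M K (average j F).
Proof.
move=> K0 FMK; split.
  move=> t; apply: le_norm_Rintegral_unit; first exact: regular_integrable FMK.
  by move=> s; apply FMK.
move=> i t s s'; have [->|ij] := eqVneq i j.
  rewrite /average; under eq_Rintegral do rewrite update_update.
  under [X in _ - X]eq_Rintegral do rewrite update_update.
  by rewrite subrr normr0 mulr_ge0.
rewrite /average -RintegralB//; [|exact: regular_integrable FMK..].
apply: le_norm_Rintegral_unit.
  apply: (@continuous_bounded_integrable (M + M)).
    by move=> x; apply: cvgB; apply: (regular_continuous (FMK)).
  by move=> u; rewrite (le_trans (ler_normB _ _))// lerD//; apply FMK.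
by move=> u; rewrite !(updateC _ _ _ ij); apply FMK.
Qed.

(** The outermost integral is over coordinate [m.-1], so that the recursion matches the one in
    [potential]. *)
Fixpoint iter_average m F : point -> R :=
  if m is p.+1 then average p (iter_average p F) else F.

Lemma iter_average_regular m M K F : (forall i, 0 <= K i) ->
  regular M K F -> regular M K (iter_average m F).
Proof.
by move=> K0 FMK; elim: m => //= m IH; exact: average_regular.
Qed.

Lemma iter_averageS m F t :
  iter_average m.+1 F t = \int[mu]_(s in D) iter_average m F (update t m s).
Proof. by []. Qed.

Lemma iter_average_affine m M M' K K' F F' (a b c : R) t :
  (forall i, 0 <= K i) -> (forall i, 0 <= K' i) ->
  regular M K F -> regular M' K' F' ->
  iter_average m (fun t => a * F t + b * F' t + c) t =
  a * iter_average m F t + b * iter_average m F' t + c.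
Proof.
move=> K0 K'0 rF rF'; elim: m t => [//|m IH] t.
rewrite !iter_averageS; under eq_Rintegral do rewrite IH.
have i1 := regular_integrable t m (iter_average_regular m K0 rF).
have i2 := regular_integrable t m (iter_average_regular m K'0 rF').
have i1a : mu.-integrable D
    (EFin \o (fun s => a * iter_average m F (update t m s))).
  by have /= := integrableZl _ a i1; exact.
have i2b : mu.-integrable D
    (EFin \o (fun s => b * iter_average m F' (update t m s))).
  by have /= := integrableZl _ b i2; exact.
rewrite RintegralD//; last 2 first.
  by have /= := integrableD _ i1a i2b; exact.
  exact: cst_integrable.
by rewrite RintegralD// !RintegralZl// Rintegral_unit_cst.
Qed.

Lemma iter_average_le m M M' K K' F F' t :
  (forall i, 0 <= K i) -> (forall i, 0 <= K' i) ->
  regular M K F -> regular M' K' F' -> 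
  (forall u, (forall i, (m <= i)%N -> u i = t i) -> F u <= F' u) ->
  iter_average m F t <= iter_average m F' t.
Proof.
move=> K0 K'0 rF rF'; elim: m t => [|m IH] t FF'; first exact: FF'.
rewrite !iter_averageS; apply: le_Rintegral => //.
- exact: regular_integrable (iter_average_regular m K0 rF).
- exact: regular_integrable (iter_average_regular m K'0 rF').
- move=> s _; apply: IH => u ut; apply: FF' => i mi.
  by rewrite ut 1?ltnW// update_neq// gtn_eqF.
Qed.

Lemma iter_average_cst m (c : R) t : iter_average m (fun=> c) t = c.
Proof.
elim: m t => [//|m IH] t; rewrite iter_averageS.
by under eq_Rintegral do rewrite IH; rewrite Rintegral_unit_cst.
Qed.

(** Coordinate [j] is a mere parameter for averages over the coordinates below [m]. *)
Lemma iter_average_update m F j (h : R -> R) t : (m <= j)%N ->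
  iter_average m (fun u => F (update u j (h (u j)))) t =
  iter_average m F (update t j (h (t j))).
Proof.
elim: m t => [//|m IH] t mj; rewrite !iter_averageS.
apply: eq_Rintegral => s _; rewrite IH 1?ltnW//.
by rewrite update_neq ?gtn_eqF// updateC// ltn_eqF.
Qed.

End iterated_integral.

(** * Volumes of the sections of a countable cover *)

Section volume_potential.
Context {R : realType}.
Local Notation mu := (@lebesgue_measure R).
Local Notation D := (`[0%R, 1%R[%classic : set R).
Local Notation point := (nat -> R).
Local Open Scope ereal_scope.

(* The volume of the section of a box in which the coordinates in [p] are
   fixed to those of [t]. *)
Definition box_volume (n : nat) (E : nat -> set R) (p : pred nat) (t : point) :
    \bar R :=
  \prod_(j < n) (if p j then (\1_(E j) (t j))%:E else mu (E j `&` `[0%R, 1%R])).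

Lemma box_volume_ge0 n E p t : 0 <= box_volume n E p t.
Proof.
by apply: prode_ge0 => j _; case: ifP => // _; rewrite lee_fin.
Qed.

Lemma box_volume_eq n E (p q : pred nat) (t u : point) :
  (forall j, (j < n)%N -> p j = q j /\ (q j -> t j = u j)) ->
  box_volume n E p t = box_volume n E q u.
Proof.
move=> pq; apply: eq_bigr => j _; have [-> tu] := pq j (ltn_ord j).
by case: ifP => // /tu ->.
Qed.

Lemma box_volume_update n E (p : pred nat) t j s : (j < n)%N ->
  box_volume n E (fun i => (i == j) || p i) (update t j s) =
  (\1_(E j) s)%:E *
  \prod_(i < n | i != j :> nat)
    (if p i then (\1_(E i) (t i))%:E else mu (E i `&` `[0%R, 1%R])).
Proof.
move=> jn; rewrite /box_volume (bigD1 (Ordinal jn))//= eqxx update_same.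
congr (_ * _); apply: eq_bigr => i ij.
by rewrite -(inj_eq val_inj)/= in ij; rewrite (negbTE ij) update_neq.
Qed.

Lemma box_volume_split n E (p : pred nat) t j : (j < n)%N -> ~~ p j ->
  box_volume n E p t = mu (E j `&` `[0%R, 1%R]) *
  \prod_(i < n | i != j :> nat)
    (if p i then (\1_(E i) (t i))%:E else mu (E i `&` `[0%R, 1%R])).
Proof.
move=> jn pj; rewrite /box_volume (bigD1 (Ordinal jn))//= (negbTE pj).
by congr (_ * _).
Qed.

Lemma box_volume_update_out n E (p : pred nat) t j s : (n <= j)%N ->
  box_volume n E (fun i => (i == j) || p i) (update t j s) =
  box_volume n E p t.
Proof.
move=> nj; apply: box_volume_eq => i iltn.
have ij : i != j by rewrite ltn_eqF// (leq_trans iltn).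
by rewrite (negbTE ij) update_neq.
Qed.

Lemma measurable_box_volume n E (p : pred nat) t j : measurable (E j) ->
  measurable_fun [set: R]
    (fun s => box_volume n E (fun i => (i == j) || p i) (update t j s)).
Proof.
move=> mE; have [nj|jn] := leqP n j.
  under eq_fun do rewrite box_volume_update_out//.
  exact: measurable_cst.
under eq_fun do rewrite box_volume_update//.
apply: emeasurable_funM; last exact: measurable_cst.
by apply/measurable_EFinP; exact: measurable_indic.
Qed.

(** Integration turns the indicator of [E j] into the measure of its part in [D]. The inequality
    comes from the end point 1, which [D] omits and [box_volume] includes. *)
Lemma integral_box_volume_le n E (p : pred nat) t j :
  measurable (E j) -> ~~ p j ->
  \int[mu]_(s in D) box_volume n E (fun i => (i == j) || p i) (update t j s) <=
  box_volume n E p t.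
Proof.
move=> mE pj; have [nj|jn] := leqP n j.
  under eq_integral do rewrite box_volume_update_out//.
  by rewrite integral_cst//= mu_unit mule1.
have mI : measurable_fun D (fun s : R => (\1_(E j) s)%:E : \bar R).
  by apply/measurable_EFinP; exact: measurable_indic.
set P := \prod_(i < n | i != j :> nat)
    (if p i then (\1_(E i) (t i))%:E else mu (E i `&` `[0%R, 1%R])).
have P0 : 0 <= P.
  by apply: prode_ge0 => i _; case: ifP => // _; rewrite lee_fin.
have -> : \int[mu]_(s in D)
      box_volume n E (fun i => (i == j) || p i) (update t j s) =
    (\int[mu]_(s in D) (\1_(E j) s)%:E) * P.
  have I0 s : D s -> 0 <= (\1_(E j) s)%:E :> \bar R by rewrite lee_fin.
  rewrite -ge0_integralZr//.
  by apply: eq_integral => s _; rewrite (box_volume_update _ _ _ _ jn).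
rewrite integral_indic// (box_volume_split _ _ jn)//.
apply: lee_wpmul2r => //.
apply: le_measure; rewrite ?inE.
- exact: measurableI.
- exact: measurableI.
- by apply: setIS => x /=; rewrite !in_itv/= => /andP[-> /ltW].
Qed.

Variables (n : nat -> nat) (E : nat -> nat -> set R).
Hypothesis mE : forall k j, measurable (E k j).

(** At [pred0] this is the total volume of the cover; at [leq 0], where every coordinate is fixed,
    it counts the boxes that contain [t]. *)
Definition volume (p : pred nat) (t : point) : \bar R :=
  \sum_(0 <= k <oo) box_volume (n k) (E k) p t.

Lemma volume_ge0 p t : 0 <= volume p t.
Proof. by apply: nneseries_ge0 => k _ _; exact: box_volume_ge0. Qed.

Lemma measurable_volume (p : pred nat) t j : measurable_fun [set: R]
  (fun s => volume (fun i => (i == j) || p i) (update t j s)).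
Proof.
apply: ge0_emeasurable_sum => k; last by move=> _; exact: measurable_box_volume.
by move=> s _ _; exact: box_volume_ge0.
Qed.

Lemma integral_volume_le (p : pred nat) t j : ~~ p j ->
  \int[mu]_(s in D) volume (fun i => (i == j) || p i) (update t j s) <=
  volume p t.
Proof.
move=> pj; rewrite integral_nneseries//.
- apply: lee_nneseries => k _; last exact: integral_box_volume_le.
  by move=> _; apply: integral_ge0 => s _; exact: box_volume_ge0.
- by move=> k; apply: measurable_funTS; exact: measurable_box_volume.
- by move=> k s _; exact: box_volume_ge0.
Qed.

(** Passing from [leq m.+1] to [leq m] fixes exactly one more coordinate, namely [m]. *)
Lemma volume_potential : potential (fun m => volume (leq m)).
Proof.
move=> m t; have -> : leq m = (fun i => (i == m) || (m.+1 <= i)%N).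
  by apply/funext => i; rewrite leq_eqVlt eq_sym.
split; first exact: volume_ge0.
  exact: measurable_volume.
by apply: integral_volume_le; rewrite ltnn.
Qed.

(* Kakutani's argument: fixing the coordinates [m], [m.+1], ... successively
   without increasing the volume of the sections. *)
Lemma exists_tail m : exists2 t : point, (forall j, D (t j)) &
  volume (leq m) t <= volume pred0 (fun=> 0%R).
Proof.
pose p i : pred nat := fun j => (m <= j < m + i)%N.
have step i t : exists s, D s /\
    volume (p i.+1) (update t (m + i)%N s) <= volume (p i) t.
  have -> : p i.+1 = (fun j => (j == m + i)%N || p i j).
    apply/funext => j; rewrite /p addnS ltnS (leq_eqVlt j) andb_orr.
    by case: eqP => [->|_]; rewrite ?leq_addr ?andbF.
  have [|s Ds sle] := exists_le_integral _ (measurable_volume (p i) t (m + i)%N).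
    by move=> s; exact: volume_ge0.
  exists s; split => //; apply: (le_trans sle).
  by apply: integral_volume_le; rewrite /p ltnn andbF.
have {}step i : exists f : point -> R, forall t, D (f t) /\
    volume (p i.+1) (update t (m + i)%N (f t)) <= volume (p i) t.
  by have [f fP] := choice (step i); exists f.
have {step}[h hP] := choice step.
pose fix T i : point :=
  if i is i'.+1 then update (T i') (m + i')%N (h i' (T i')) else (fun=> 0%R).
have TD i j : D (T i j).
  elim: i => [|i IH] /=; first by rewrite in_itv/= lexx ltr01.
  by rewrite /update; case: eqP => // _; have [] := hP i (T i).
have TV i : volume (p i) (T i) <= volume pred0 (fun=> 0%R).
  elim: i => [|i IH] /=; last by apply: le_trans IH; have [] := hP i (T i).
  rewrite (_ : p 0%N = pred0)//; apply/funext => j.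
  by rewrite /p addn0; case: leqP.
have Tfix i d j : (j < m + i)%N -> T (i + d)%N j = T i j.
  elim: d => [|d IH] ji; first by rewrite addn0.
  rewrite addnS /= update_neq ?IH// ltn_eqF// (leq_trans ji)//.
  by rewrite leq_add2l leq_addr.
(* Stages from [i] on agree on the coordinates below [m + i], so coordinate [j] has its final value
   at stage [j.+1]. *)
pose t j := T j.+1 j.
have tT i j : (j < m + i)%N -> T i j = t j.
  move=> ji; rewrite /t -(Tfix i j.+1)// addnC Tfix//.
  by rewrite addnS ltnS leq_addl.
exists t => [j|]; first exact: TD.
apply: lime_le; first by apply: is_cvg_nneseries => k _ _; exact: box_volume_ge0.
(* The first [N] boxes constrain only coordinates below [I], where [t] agrees with the stage [T I];
   each partial sum is thus bounded by the volume at a finite stage. *)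
apply: nearW => N; pose I := (\sum_(k < N) n k)%N.
apply: (le_trans _ (TV I)).
apply: (@le_trans _ _ (\sum_(0 <= k < N) box_volume (n k) (E k) (p I) (T I))).
  rewrite !big_mkord; apply: lee_sum => k _.
  rewrite (@box_volume_eq _ _ _ (p I) _ (T I))// => j jn.
  have jI : (j < m + I)%N.
    rewrite (leq_trans jn)// (leq_trans _ (leq_addl _ _))//.
    by rewrite /I (bigD1 k)//= leq_addr.
  by rewrite /p jI andbT tT.
by apply: nneseries_lim_ge => k _ _; exact: box_volume_ge0.
Qed.

(** A box containing [t] would alone contribute 1 to the sum. *)
Lemma volume_lt1 t : volume (leq 0) t < 1 ->
  forall k, exists2 j, (j < n k)%N & ~ E k j (t j).
Proof.
move=> V1 k; apply: contrapT => /forall2NP h.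
move: V1; apply/negP; rewrite -leNgt.
have -> : 1 = box_volume (n k) (E k) (leq 0) t.
  rewrite /box_volume big1// => j _; rewrite indicE mem_set//.
  by case: (h j) => // /contrapT.
apply: le_trans (nneseries_lim_ge k.+1 _) => [|i _ _]; last first.
  exact: box_volume_ge0.
rewrite big_nat_recr//= leeDr// sume_ge0// => i _; exact: box_volume_ge0.
Qed.

End volume_potential.

(** * Null sets of the cube *)

Section null_sets.
Context {R : realType}.
Local Notation mu := (@lebesgue_measure R).
Local Notation D := (`[0%R, 1%R[%classic : set R).
Local Notation point := (nat -> R).

(** A 1-Lipschitz retraction onto [0, 1]: composing with it extends maps from the cube to [nat -> R]
    without enlarging Lipschitz constants, and makes them constant in each coordinate beyond 1. *)
Definition clamp (s : R) : R := Num.max 0 (Num.min s 1).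

Lemma clamp_itv s : `[0, 1]%classic (clamp s).
Proof.
by rewrite /= in_itv/= /clamp le_max lexx/= ge_max ler01 ge_min lexx orbT.
Qed.

Lemma clamp_id s : `[0, 1]%classic s -> clamp s = s.
Proof.
by rewrite /= in_itv/= => /andP[s0 s1]; rewrite /clamp min_l// max_r.
Qed.

Lemma clamp_ge1 s : 1 <= s -> clamp s = 1.
Proof. by move=> s1; rewrite /clamp min_r// max_r. Qed.

Lemma clamp_lipschitz s s' : `|clamp s - clamp s'| <= `|s - s'|.
Proof.
wlog ss' : s s' / s' <= s.
  by case/orP: (le_total s s') => h H; [rewrite distrC (distrC s)|]; exact: H.
rewrite [leRHS]ger0_norm ?subr_ge0// ler_norml /clamp.
case: (leP s 1) => ?; case: (leP s' 1) => ?;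
  repeat match goal with
  |- context [Order.max 0 ?x] => case: (leP 0 x) => ?
  end; lra.
Qed.

Definition to_unit (s : R) : unit_interval R :=
  exist _ (clamp s) (mem_set (clamp_itv s)).

Definition to_cube (t : point) : cube R := fun j => to_unit (t j).

Lemma val_to_unit s : \val (to_unit s) = clamp s.
Proof. by []. Qed.

Lemma to_unitK (s : unit_interval R) : to_unit (\val s) = s.
Proof. by apply: val_inj; rewrite val_to_unit clamp_id//; exact: set_valP. Qed.

Lemma to_cube_update t j s :
  to_cube (update t j s) = dfwith (to_cube t) j (to_unit s).
Proof.
apply/funext => i; rewrite /to_cube /update.
by case: dfwithP => [|k /negbTE]; [rewrite eqxx|rewrite eq_sym => ->].
Qed.

Lemma product_lebesgue0_cover (A : set (cube R)) (e : R) :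
  product_lebesgue A = 0%E -> 0 < e ->
  exists (n : nat -> nat) (E : nat -> nat -> set R),
    [/\ forall k j, measurable (E k j), A `<=` \bigcup_k cylinder (n k) (E k) &
        (\sum_(0 <= k <oo) cylinder_volume (n k) (E k) < e%:E)%E].
Proof.
move=> A0 e0; have : (product_lebesgue A < e%:E)%E by rewrite A0 lte_fin.
by case/ereal_inf_lt => _ [n [E [mE AE ->]]] ltE; exists n, E.
Qed.

Lemma cylinder_volume_ge0 n (E : nat -> set R) : (0 <= cylinder_volume n E)%E.
Proof. by apply: prode_ge0. Qed.

(** Two covers of volume below [e / 2] are interleaved, one on the even and one on the odd indices;
    partial sums of even length split into the two separate ones. *)
Lemma product_lebesgue0U (A B : set (cube R)) :
  product_lebesgue A = 0%E -> product_lebesgue B = 0%E ->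
  product_lebesgue (A `|` B) = 0%E.
Proof.
move=> A0 B0; apply/eqP; rewrite eq_le; apply/andP; split; last first.
  apply: le_ereal_inf_tmp => _ [n [E [_ _ ->]]].
  by apply: nneseries_ge0 => k _ _; exact: cylinder_volume_ge0.
apply/lee_addgt0Pr => e e0; rewrite add0e.
have e2 : 0 < e / 2 by rewrite divr_gt0.
have [n [E [mE AE sE]]] := product_lebesgue0_cover A0 e2.
have [n' [E' [mE' BE' sE']]] := product_lebesgue0_cover B0 e2.
pose p k := if odd k then n' k./2 else n k./2.
pose F k := if odd k then E' k./2 else E k./2.
apply: (@le_trans _ _ (\sum_(0 <= k <oo) cylinder_volume (p k) (F k))%E).
  apply: ereal_inf_lbound; exists p, F; split => //.
    by move=> k j; rewrite /F; case: ifP.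
  move=> t [/AE|/BE'] [k _ Ck].
    by exists k.*2 => //; rewrite /p /F odd_double doubleK.
  by exists k.*2.+1 => //; rewrite /p /F /= odd_double/= uphalf_double.
apply: lime_le.
  by apply: is_cvg_nneseries => k _ _; exact: cylinder_volume_ge0.
apply: nearW => N.
have F0 k : (0 <= cylinder_volume (p k) (F k))%E by exact: cylinder_volume_ge0.
apply: (@le_trans _ _ (\sum_(0 <= k < N.*2) cylinder_volume (p k) (F k))%E).
  by apply: lee_sum_nneg_natr => //; rewrite -addnn leq_addr.
have -> : (\sum_(0 <= k < N.*2) cylinder_volume (p k) (F k) =
    \sum_(0 <= k < N) cylinder_volume (n k) (E k) +
    \sum_(0 <= k < N) cylinder_volume (n' k) (E' k))%E.
  elim: N => [|N IH]; first by rewrite !big_geq// adde0.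
  rewrite doubleS !big_nat_recr//= IH /p /F /= odd_double /= doubleK uphalf_double.
  by rewrite addeACA -!addeA.
rewrite [e in leRHS]splitr EFinD; apply: leeD.
  apply: le_trans (ltW sE); apply: nneseries_lim_ge => k _ _.
  exact: cylinder_volume_ge0.
apply: le_trans (ltW sE'); apply: nneseries_lim_ge => k _ _.
exact: cylinder_volume_ge0.
Qed.

(** The integral inequality of [potential] is here Fatou's lemma, the integrals on its right side
    being the averages over one more coordinate. *)
Lemma liminf_average_potential (M : nat -> R) (K : nat -> nat -> R)
    (H : nat -> point -> R) :
  (forall n j, 0 <= K n j) -> (forall n, regular (M n) (K n) (H n)) ->
  (forall n t, 0 <= H n t) ->
  potential (fun m t => limn_einf (fun n => (iter_average m (H n) t)%:E)).
Proof.
move=> K0 rH H0 m t.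
have J0 n p u : 0 <= iter_average p (H n) u.
  rewrite -(iter_average_cst p 0 u).
  have r0 : regular 0 (fun=> 0) (fun=> 0 : R).
    by split=> [v|j v s s']; rewrite ?subrr normr0// mul0r.
  exact: (iter_average_le _ _ r0 (rH n)).
have mJ n : measurable_fun [set: R]
    (fun s => (iter_average m (H n) (update t m s))%:E).
  apply/measurable_EFinP; apply: continuous_measurable_fun.
  exact: regular_continuous (iter_average_regular m (K0 n) (rH n)).
split.
- rewrite limn_einf_lim; apply: lime_ge; first exact: is_cvg_einfs.
  by apply: nearW => n; apply: le_ereal_inf_tmp => _ [k _ <-]; rewrite lee_fin.
- have mN n : measurable_fun [set: R]
      (fun s => (- (iter_average m (H n) (update t m s))%:E)%E).
    exact: measurableT_comp.
  exact: measurableT_comp (measurable_fun_limn_esup mN).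
- have mJD n : measurable_fun D
      (fun s : R => (iter_average m (H n) (update t m s))%:E).
    exact: measurable_funTS.
  have J0D n s : D s -> (0 <= (iter_average m (H n) (update t m s))%:E)%E.
    by rewrite lee_fin.
  apply: (le_trans (fatou mu _ mJD J0D)) => //.
  rewrite le_eqVlt; apply/orP; left; apply/eqP; congr limn_einf.
  apply/funext => n; rewrite iter_averageS /Rintegral fineK//.
  apply: integrable_fin_num => //.
  exact: regular_integrable (iter_average_regular m (K0 n) (rH n)).
Qed.

(** The tail comes from [exists_tail], the first [m] coordinates from [potential_select] applied to
    the lower limit plus [c] times the volume. Both summands are nonnegative, so a bound on the sum
    bounds each. *)
Lemma exists_notin_null (A : set (cube R)) (m : nat) (M : nat -> R)
    (K : nat -> nat -> R) (H : nat -> point -> R) (d e : R) :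
  product_lebesgue A = 0%E ->
  (forall n j, 0 <= K n j) -> (forall n, regular (M n) (K n) (H n)) ->
  (forall n t, 0 <= H n t) ->
  (forall t, (limn_einf (fun n => (iter_average m (H n) t)%:E) <= d%:E)%E) ->
  0 < e ->
  exists t, [/\ forall j, D (t j), ~ A (to_cube t) &
    (limn_einf (fun n => (H n t)%:E) <= (d + e)%:E)%E].
Proof.
move=> A0 K0 rH H0 Jd e0.
have pJ := liminf_average_potential K0 rH H0.
have d0 : 0 <= d.
  by rewrite -lee_fin; apply: le_trans (Jd (fun=> 0)); have [] := pJ m (fun=> 0).
(* A cover of volume below [e / c] costs at most [e] after weighting by [c]; as [c] exceeds [d + e],
   a final sum of at most [d + e] forces the volume below 1. *)
pose c := d + e + 1; have c0 : 0 < c by rewrite /c; lra.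
have [n [E [mE AE sE]]] := product_lebesgue0_cover A0 (divr_gt0 e0 c0).
have [t tD tV] := exists_tail n mE m.
have pW := potentialD pJ (potentialZ (ltW c0) (volume_potential n mE)).
have [u [uD ut uW]] := potential_select m t pW.
have L0 : (0 <= limn_einf (fun n => (H n u)%:E))%E by have [] := pJ 0%N u.
have V0 : (0 <= c%:E * volume n E (leq 0) u)%E.
  by apply: mule_ge0; [rewrite lee_fin ltW|exact: volume_ge0].
have {}uW : (limn_einf (fun n => (H n u)%:E) + c%:E * volume n E (leq 0) u <=
    (d + e)%:E)%E.
  apply: (le_trans uW); rewrite (EFinD d e); apply: (@leeD _ _ _ _ _ (Jd t)).
  apply: (@le_trans _ _ (c%:E * (e / c)%:E)%E).
    rewrite lee_wpmul2l ?lee_fin ?ltW//; apply: (le_lt_trans tV).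
    by apply: le_lt_trans sE; apply: lee_nneseries => // k _; rewrite box_volume_ge0.
  by rewrite -EFinM lee_fin mulrC divfK// gt_eqF.
exists u; split.
- by move=> j; have [mj|jm] := leqP m j; [rewrite ut|exact: uD].
- have V1 : (volume n E (leq 0) u < 1)%E.
    rewrite -(@lte_pmul2l _ c%:E) ?lte_fin//.
    apply: (@le_lt_trans _ _ (d + e)%:E).
      by apply: le_trans uW; rewrite leeDr.
    by rewrite mule1 lte_fin /c ltrDl.
  move=> /AE[k _ Ck]; have [j jn] := volume_lt1 V1 k; apply.
  have := Ck _ jn; rewrite /to_cube val_to_unit clamp_id//.
  have : D (u j) by have [mj|jm] := leqP m j; [rewrite ut|exact: uD].
  by rewrite /= !in_itv/= => /andP[-> /ltW ->].
- by apply: le_trans uW; rewrite leeDl.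
Qed.

End null_sets.

(** * Difference quotients *)

Section shift_average.
Context {R : realType}.
Local Notation mu := (@lebesgue_measure R).
Local Notation D := (`[0%R, 1%R[%classic : set R).
Local Notation point := (nat -> R).

Lemma continuous_increment (psi : R -> R) (a : R) :
  continuous psi -> continuous (fun s => psi (s + a) - psi s).
Proof.
move=> cpsi x; apply: cvgB; last exact: cpsi.
apply: (@continuous_comp _ _ _ (fun s : R => s + a) psi); last exact: cpsi.
by apply: cvgD; [exact: cvg_id|exact: cvg_cst].
Qed.

(* With [P] a primitive of [psi], the integral of [psi (s + a) - psi s] is
   [(P (1 + a) - P 1) - (P a - P 0)]. *)
Lemma integral_shift_ge (k a : R) (psi : R -> R) :
  (forall s s', `|psi s - psi s'| <= k * `|s - s'|) ->
  (forall s, 1 <= s -> psi s = psi 1) -> 0 < a <= 1 ->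
  a * (psi 1 - psi 0 - k * a) <= \int[mu]_(s in D) (psi (s + a) - psi s).
Proof.
move=> psik psi1 /andP[a0 a1].
have cpsi : continuous psi by exact: lipschitz_continuous_fun psik.
pose P (x : R) := \int[mu]_(t in `[-1, x]) psi t.
(* The margins of [-1, 3] make both [s] and [s + a] interior points for every [s] near [0, 1], since
   [a <= 1]. *)
have ipsi : mu.-integrable `[-1, 3] (EFin \o psi).
  apply: continuous_compact_integrable; first exact: segment_compact.
  by apply: continuous_subspaceT => x; exact: cpsi.
have dP (x : R) : -1 < x < 3 -> is_derive x 1 P (psi x).
  move=> /andP[x1 x3].
  have [dPx PE] := continuous_FTC1_closed x3 ipsi x1 (cpsi x).
  by rewrite -PE derive1E; exact: derivableP.
have cP (x : R) : -1 < x < 3 -> {for x, continuous P}.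
  by move=> /dP [dPx _]; apply: differentiable_continuous; apply/derivable1_diffP.
pose Q (s : R) := P (s + a) - P s.
have dQ (x : R) : -1 < x < 2 -> is_derive x 1 Q (psi (x + a) - psi x).
  move=> /andP[x1 x2].
  have d1 : is_derive (x + a) 1 P (psi (x + a)) by apply: dP; lra.
  have d2 : is_derive x 1 P (psi x) by apply: dP; lra.
  have d3 : is_derive x 1 (fun s => P (s + a)) (psi (x + a)).
    have d4 : is_derive x 1 (fun s : R => s + a) 1.
      by apply: is_derive_eq; rewrite addr0.
    have c1 : derivable P (x + a) 1 by case: d1.
    have c4 : derivable (fun s : R => s + a) x 1 by case: d4.
    apply: DeriveDef.
      apply/derivable1_diffP.
      apply: (@differentiable_comp _ _ _ _ (fun s => s + a) P).
        exact/derivable1_diffP.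
      exact/derivable1_diffP.
    rewrite -derive1E (@derive1_comp _ (fun s => s + a) P)// !derive1E.
    by rewrite (@derive_val _ _ _ _ _ _ _ d1) (@derive_val _ _ _ _ _ _ _ d4) mulr1.
  exact: is_deriveB.
have FTC : \int[mu]_(s in `[0, 1]) (psi (s + a) - psi s) = Q 1 - Q 0.
  rewrite /Rintegral (@continuous_FTC2 _ _ Q)//.
  - apply: continuous_subspaceT => x; exact: continuous_increment.
  - have cQ (x : R) : -1 < x < 2 -> {for x, continuous Q}.
      move=> /dQ [dQx _]; apply: differentiable_continuous.
      exact/derivable1_diffP.
    split.
    + move=> x; rewrite in_itv/= => x01.
      by have [] : is_derive x 1 Q (psi (x + a) - psi x) by apply: dQ; lra.
    + by apply: cvg_at_right_filter; apply: cQ; lra.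
    + by apply: cvg_at_left_filter; apply: cQ; lra.
  - move=> x; rewrite in_itv/= => x01; rewrite derive1E.
    by have [] : is_derive x 1 Q (psi (x + a) - psi x) by apply: dQ; lra.
have iD : mu.-integrable D (EFin \o (fun s => psi (s + a) - psi s)).
  apply: (@integrableS _ _ _ mu `[0, 1]%classic) => //.
    by move=> x /=; rewrite !in_itv/= => /andP[-> /ltW].
  apply: continuous_compact_integrable; first exact: segment_compact.
  apply: continuous_subspaceT => x; exact: continuous_increment.
rewrite Rintegral_itv_bndo_bndc// FTC /Q.
have mvt (u v : R) : -1 < u -> u <= v -> v < 3 ->
    exists2 c, c \in `[u, v] & P v - P u = psi c * (v - u).
  move=> u1 uv v3; apply: MVT_segment => //.
    by move=> x; rewrite in_itv/= => xuv; apply: dP; lra.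
  apply: continuous_in_subspaceT => x; rewrite inE/= in_itv/= => xuv.
  by apply: cP; lra.
(* Beyond 1 the value of [psi] is exactly [psi 1]; on [0, a] it is at most [psi 0 + k * a], which is
   the only loss. *)
have [|||c + PE] := mvt 1 (1 + a); [lra..|].
rewrite in_itv/= => /andP[c1 _].
have [|||c' + PE'] := mvt 0 (0 + a); [lra..|].
rewrite in_itv/= => c'0.
rewrite PE PE' (psi1 c)//.
have := psik c' 0; rewrite subr0 (@ger0_norm _ c'); last lra.
rewrite ler_norml => /andP[_ psic'].
have k0 : 0 <= k.
  by have := psik 1 0; rewrite subr0 normr1 mulr1; apply: le_trans.
have : k * c' <= k * a by apply: ler_wpM2l => //; lra.
move=> kc'; have -> : 1 + a - 1 = a by ring.
have -> : 0 + a - 0 = a by ring.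
rewrite -mulrBl mulrC.
by apply: ler_wpM2r; [exact: ltW|lra].
Qed.

Lemma regular_affine (M M' : R) (K K' : nat -> R) (F F' : point -> R)
    (a b c : R) :
  regular M K F -> regular M' K' F' ->
  regular (`|a| * M + `|b| * M' + `|c|) (fun j => `|a| * K j + `|b| * K' j)
    (fun u => a * F u + b * F' u + c).
Proof.
move=> [FM FK] [F'M F'K]; split=> [u|j u s s'].
  rewrite (le_trans (ler_normD _ _))// lerD2r (le_trans (ler_normD _ _))//.
  by rewrite !normrM lerD// ler_wpM2l.
set x := F _; set y := F' _; set z := F _; set w := F' _.
rewrite (_ : _ - _ = a * (x - z) + b * (y - w)); last by ring.
rewrite (le_trans (ler_normD _ _))// !normrM mulrDl -!mulrA.
by apply: lerD; apply: ler_wpM2l => //; [exact: FK|exact: F'K].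
Qed.

Lemma regular_shift (i : nat) (M a : R) (K : nat -> R) (g : point -> R) :
  regular M K g -> regular M K (fun u => g (update u i (u i + a))).
Proof.
move=> rg; split=> [u|j u s s']; first by apply rg.
have [->|ji] := eqVneq j i.
  rewrite !update_same !update_update (_ : s - s' = s + a - (s' + a)).
    by apply rg.
  by rewrite opprD addrACA subrr addr0.
have ij : i != j by rewrite eq_sym.
by rewrite !(update_neq _ _ ij) !(updateC _ _ _ ji); apply rg.
Qed.

Lemma iter_average_ge (p m : nat) (M c : R) (K : nat -> R) (F : point -> R) t :
  (forall j, 0 <= K j) -> regular M K F -> (p <= m)%N ->
  (forall u, c <= iter_average p F u) -> c <= iter_average m F t.
Proof.
move=> K0 rF pm Fc; elim: m t pm => [|m IH] t.
  by rewrite leqn0 => /eqP p0; move: Fc; rewrite p0; exact.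
rewrite leq_eqVlt ltnS => /predU1P[<-//|pm].
rewrite iter_averageS -[leLHS]Rintegral_unit_cst; apply: le_Rintegral => //.
- exact: cst_integrable.
- exact: regular_integrable (iter_average_regular m K0 rF).
- by move=> s _; exact: IH.
Qed.

(** Averaging over the coordinates below [i] commutes with the shift in coordinate [i], so the
    average over coordinate [i] is a one-variable integral of an increment of [psi], to which
    [integral_shift_ge] applies. The averages over later coordinates keep a lower bound that is
    uniform in the point. *)
Lemma average_shift_quotient_ge (i : nat) (M a b : R) (K : nat -> R)
    (g : point -> R) (m : nat) (t : point) :
  (forall j, 0 <= K j) -> regular M K g ->
  (forall t s, 1 <= s -> g (update t i s) = g (update t i 1)) ->
  (forall t, b <= g (update t i 1) - g (update t i 0)) ->
  0 < a <= 1 -> (i < m)%N ->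
  b - K i * a <=
  iter_average m (fun u => a^-1 * (g (update u i (u i + a)) - g u)) t.
Proof.
move=> K0 rg g1 gb /andP[a0 a1] im.
pose S u := g (update u i (u i + a)).
have rS : regular M K S by exact: regular_shift.
pose q u := a^-1 * S u + - a^-1 * g u + 0.
have -> : (fun u => a^-1 * (g (update u i (u i + a)) - g u)) = q.
  by apply/funext => u; rewrite /q addr0 mulrBr mulNr.
have [Mq [Kq [Kq0 rq]]] : exists M' K', (forall j, 0 <= K' j) /\ regular M' K' q.
  have := regular_affine a^-1 (- a^-1) 0 rS rg.
  move=> r; do 2 eexists; split; [|exact: r].
  by move=> j /=; rewrite addr_ge0// mulr_ge0.
suff qi u : b - K i * a <= iter_average i.+1 q u.
  exact: (iter_average_ge t Kq0 rq im qi).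
move: u => {}t.
rewrite iter_averageS; pose psi s := iter_average i g (update t i s).
have rG := iter_average_regular i K0 rg.
have psik s s' : `|psi s - psi s'| <= K i * `|s - s'| by apply rG.
have psiE s : psi s = iter_average i (fun u => g (update u i s)) t.
  by rewrite (iter_average_update g (fun=> s) t (leqnn i)).
have psi1 s : 1 <= s -> psi s = psi 1.
  by move=> s1; rewrite !psiE; congr iter_average; apply/funext => u; rewrite g1.
have rU c : regular M K (fun u => g (update u i c)).
  split=> [u|j u s s']; first by apply rg.
  have [->|ji] := eqVneq j i.
    by rewrite !update_update subrr normr0 mulr_ge0.
  by rewrite !(updateC _ _ _ ji); apply rg.
have psib : b <= psi 1 - psi 0.
  have := iter_average_affine i 1 (-1) 0 t K0 K0 (rU 1) (rU 0).
  rewrite -!psiE mul1r mulN1r addr0 => <-.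
  rewrite -[leLHS](iter_average_cst i b t).
  have rb : regular `|b| (fun=> 0) (fun=> b : R).
    by split=> [v|j v s s'] //; rewrite subrr normr0 mul0r.
  apply: (iter_average_le _ _ rb (regular_affine 1 (-1) 0 (rU 1) (rU 0))) => //.
    by move=> j; rewrite addr_ge0// mulr_ge0.
  by move=> u _; rewrite mul1r mulN1r addr0.
have qE s : iter_average i q (update t i s) = a^-1 * (psi (s + a) - psi s).
  rewrite (iter_average_affine _ _ _ _ _ K0 K0 rS rg) addr0 mulrBr mulNr.
  rewrite (iter_average_update g (fun r => r + a) _ (leqnn i)).
  by rewrite update_same update_update.
under eq_Rintegral do rewrite qE.
rewrite RintegralZl//; last first.
  apply: (@continuous_bounded_integrable _ (M + M)).
    apply: continuous_increment; exact: lipschitz_continuous_fun psik.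
  by move=> s; rewrite (le_trans (ler_normB _ _))// lerD//; apply rG.
rewrite -ler_pdivrMl ?invr_gt0// invrK.
apply: le_trans (integral_shift_ge psik psi1 _); last by rewrite a0.
by rewrite ler_pM2l// lerD2r.
Qed.

End shift_average.

(** * From averaged quotients to a pointwise divergence *)

Section divergence.
Context {R : realType}.
Local Notation D := (`[0%R, 1%R[%classic : set R).
Local Notation point := (nat -> R).
Local Notation a n := (harmonic n : R).

Definition regularizable (F : point -> R) :=
  exists M K, (forall j, 0 <= K j) /\ regular M K F.

Lemma regularizable_affine (F F' : point -> R) (b b' c : R) :
  regularizable F -> regularizable F' ->
  regularizable (fun u => b * F u + b' * F' u + c).
Proof.
move=> [M [K [K0 rF]]] [M' [K' [K'0 rF']]].
have r := regular_affine b b' c rF rF'.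
by do 2 eexists; split; [|exact: r]; move=> j /=; rewrite addr_ge0// mulr_ge0.
Qed.

Lemma iter_average_sum (I : Type) (s : seq I) (q : I -> point -> R) (p : nat) :
  (forall i, regularizable (q i)) ->
  regularizable (fun u => \sum_(i <- s) q i u) /\
  forall t, iter_average p (fun u => \sum_(i <- s) q i u) t =
    \sum_(i <- s) iter_average p (q i) t.
Proof.
move=> rq; elim: s => [|i s [IHr IHs]].
  have -> : (fun u => \sum_(i <- [::]) q i u) = (fun=> 0 : R).
    by apply/funext => u; rewrite big_nil.
  split; last by move=> t; rewrite big_nil iter_average_cst.
  exists 0, (fun=> 0); split => //; split=> [v|j v s s'].
    by rewrite normr0.
  by rewrite subrr normr0 mul0r.
have -> : (fun u => \sum_(i <- i :: s) q i u) =
    (fun u => 1 * q i u + 1 * \sum_(i <- s) q i u + 0).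
  by apply/funext => u; rewrite big_cons !mul1r addr0.
split; first exact: regularizable_affine.
move=> t; have [M [K [K0 rF]]] := rq i; have [M' [K' [K'0 rF']]] := IHr.
by rewrite (iter_average_affine _ _ _ _ _ K0 K'0 rF rF') IHs big_cons !mul1r addr0.
Qed.

Lemma regularizable_quotient (i : nat) (M b : R) (K : nat -> R)
    (g : point -> R) :
  (forall j, 0 <= K j) -> regular M K g ->
  regularizable (fun u => b * (g (update u i (u i + b^-1)) - g u)).
Proof.
move=> K0 rg.
have -> : (fun u => b * (g (update u i (u i + b^-1)) - g u)) =
    (fun u => b * g (update u i (u i + b^-1)) + - b * g u + 0).
  by apply/funext => u; rewrite addr0 mulrBr mulNr.
apply: regularizable_affine; exists M, K; split => //.
exact: regular_shift.
Qed.

Lemma limn_einf_le_cvg (u v : nat -> \bar R) (l : \bar R) :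
  (forall n, (u n <= v n)%E) -> v @ \oo --> l -> (limn_einf u <= l)%E.
Proof.
move=> uv /cvg_limn_einf_sup[<- _]; rewrite !limn_einf_lim.
apply: lee_lim; [exact: is_cvg_einfs|exact: is_cvg_einfs|].
apply: nearW => n; apply: le_ereal_inf_tmp => _ [k nk <-].
by apply: le_trans (uv k); apply: ereal_inf_lbound; exists k.
Qed.

(* Every partial difference quotient integrates to at least [b i] up to
   [O(1 / n)]; by Fatou's lemma the divergence is at least [\sum_i b i] on
   average, hence somewhere outside of the null set. *)
Lemma exists_divergence_ge (A : set (cube R)) (m : nat)
    (g : 'I_m -> point -> R) (M : 'I_m -> R) (K : 'I_m -> nat -> R)
    (b : 'I_m -> R) (S : point -> R) (e : R) :
  product_lebesgue A = 0%E ->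
  (forall i j, 0 <= K i j) -> (forall i, regular (M i) (K i) (g i)) ->
  (forall i t s, 1 <= s -> g i (update t i s) = g i (update t i 1)) ->
  (forall i t, b i <= g i (update t i 1) - g i (update t i 0)) ->
  (forall t, (forall j, D (t j)) -> ~ A (to_cube t) ->
    \sum_(i < m) (a n)^-1 * (g i (update t i (t i + a n)) - g i t)
      @[n --> \oo] --> S t) ->
  0 < e ->
  exists t, [/\ forall j, D (t j), ~ A (to_cube t) & \sum_(i < m) b i - e <= S t].
Proof.
move=> A0 K0 rg g1 gb gS e0.
pose q n i u := (a n)^-1 * (g i (update u (i : 'I_m) (u i + a n)) - g i u).
pose F n u := \sum_(i < m) q n i u.
(* The Lipschitz bounds give [F n <= B] for all [n], so that Fatou's lemma applies to the
   nonnegative functions [B - F n]. *)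
pose B := \sum_(i < m) K i i.
have a0 n : 0 < a n by rewrite /harmonic invr_gt0.
have a1 n : 0 < a n <= 1 by rewrite a0 /harmonic invf_le1// ler1n.
have rq n i : regularizable (q n i).
  have := regularizable_quotient i (a n)^-1 (K0 i) (rg i).
  by rewrite invrK.
have FS n := iter_average_sum (index_enum 'I_m) m (rq n).
have rF n : regularizable (F n) := (FS n).1.
have FB n u : F n u <= B.
  apply: ler_sum => i _; rewrite /q (le_trans (ler_norm _))// normrM.
  rewrite normfV (gtr0_norm (a0 n)) ler_pdivrMl//.
  have := (rg i).2 i u (u i + a n) (u i); rewrite update_id => h.
  by rewrite (le_trans h)// addrAC subrr add0r (gtr0_norm (a0 n)) mulrC.
pose H n u := -1 * F n u + 0 * F n u + B.
have HE n u : H n u = B - F n u by rewrite /H mulN1r mul0r addr0 addrC.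
have rH n : regularizable (H n) by exact: regularizable_affine.
pose MH n := projT1 (cid (rH n)).
have /(_ _)/cid-/all_sig[KH rHK] : forall n, exists K', (forall j, 0 <= K' j) /\
    regular (MH n) K' (H n).
  by move=> n; exact: projT2 (cid (rH n)).
have Jd t : (limn_einf (fun n => (iter_average m (H n) t)%:E) <=
    (B - \sum_(i < m) b i)%:E)%E.
  (* The losses [K i i * a n] of the single quotients add up to [B * a n], which tends to 0. *)
  apply: (@limn_einf_le_cvg _ (fun n => (B - \sum_(i < m) b i + B * a n)%:E)).
    move=> n; rewrite lee_fin; have [MF [KF [KF0 rFK]]] := rF n.
    rewrite (iter_average_affine _ _ _ _ _ KF0 KF0 rFK rFK).
    rewrite mulN1r mul0r addr0 addrC -addrA lerD2l.
    rewrite lerNl opprD opprK (FS n).2.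
    rewrite /B mulr_suml -sumrB; apply: ler_sum => i _.
    exact: (average_shift_quotient_ge _ (K0 i) (rg i) (g1 i) (gb i) (a1 n)).
  apply: cvg_EFin; first exact: nearW.
  rewrite -[X in _ --> X]addr0 -(mulr0 B).
  apply: cvgD; first exact: cvg_cst.
  by apply: cvgMl_tmp; exact: cvg_harmonic.
have H0 n t : 0 <= H n t by rewrite HE subr_ge0.
have [t [tD tA tH]] := exists_notin_null A0 (fun n => (rHK n).1)
  (fun n => (rHK n).2) H0 Jd e0.
exists t; split => //.
have HS : (H n t)%:E @[n --> \oo] --> (B - S t)%:E.
  have -> : (fun n => (H n t)%:E) = (fun n => (B - F n t)%:E).
    by apply/funext => n; rewrite HE.
  apply: cvg_EFin; first exact: nearW.
  by apply: cvgB; [exact: cvg_cst|exact: gS].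
move: tH; rewrite (cvg_limn_einf_sup HS).1 lee_fin.
by rewrite -addrA lerD2l lerNl opprD opprK.
Qed.

End divergence.

(** * The space of surfaces *)

Section unit_cube.
Context {R : realType}.

Lemma clamp_continuous : continuous (@clamp R).
Proof.
apply: (@lipschitz_continuous_fun _ 1) => s s'.
by rewrite mul1r clamp_lipschitz.
Qed.

Lemma to_unit_continuous : continuous (@to_unit R).
Proof.
apply: (@continuous_comp_initial _ _ _ set_val).
exact: clamp_continuous.
Qed.

Lemma val_unit_itv (s : unit_interval R) : 0 <= \val s <= 1.
Proof. by have := set_valP s; rewrite /= in_itv. Qed.

Lemma unit_val_continuous : continuous (fun s : unit_interval R => \val s : R).
Proof. exact: initial_continuous. Qed.

Lemma unit_interval_compact : compact [set: unit_interval R].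
Proof.
have -> : [set: unit_interval R] = to_unit @` `[0, 1]%classic.
  apply/seteqP; split=> // s _; exists (\val s); last exact: to_unitK.
  by rewrite /= in_itv/=; exact: val_unit_itv.
apply: continuous_compact; last exact: segment_compact.
by apply: continuous_subspaceT => x; exact: to_unit_continuous.
Qed.

Lemma cube_compact : compact [set: cube R].
Proof.
have := @tychonoff nat (fun=> unit_interval R) (fun=> setT)
  (fun=> unit_interval_compact).
by congr compact; apply/seteqP; split.
Qed.

Lemma cube_proj_continuous j : continuous (fun t : cube R => t j).
Proof. exact: (@proj_continuous nat (fun=> unit_interval R) j). Qed.

Lemma punctured_unitP (s : unit_interval R) (A : set (unit_interval R)) :
  s^' A <-> exists2 d : R, 0 < d & forall s' : unit_interval R,
    s' != s -> `|\val s - \val s'| < d -> A s'.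
Proof.
split=> [/nbhs_ballP[d d0 dA]|[d d0 dA]].
  by exists d => // s' s's ss'; exact: (dA s' ss' s's).
by apply/nbhs_ballP; exists d => // s' ss' s's; exact: dA.
Qed.

(** Makes limits of partial quotients unique, also at the end points. The nearby point [y] lies on
    the side of the midpoint, and a step of at most 1/4 in that direction stays in [0, 1]. *)
Global Instance punctured_unit_proper (s : unit_interval R) :
  ProperFilter s^'.
Proof.
apply: Build_ProperFilter_ex => A /punctured_unitP[d d0 dA].
have := val_unit_itv s; set x : R := \val s => x01.
pose h := Num.min (d / 2) (1 / 4).
have h0 : 0 < h by rewrite lt_min; apply/andP; split; lra.
have hd : h < d by rewrite gt_min; apply/orP; left; lra.
have h4 : h <= 1 / 4 by rewrite ge_min lexx orbT.
pose y := if x <= 1 / 2 then x + h else x - h.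
have y01 : `[0, 1]%classic y.
  by rewrite /= in_itv/= /y; case: ifPn; rewrite -?ltNge => ?; lra.
have xy : `|x - y| = h.
  rewrite /y; case: ifP => _; first by rewrite opprD addNKr normrN gtr0_norm.
  by rewrite subKr gtr0_norm.
exists (to_unit y); apply: dA; last by rewrite val_to_unit clamp_id// -/x xy.
apply/negP => /eqP ys; move: xy.
by rewrite /x -ys val_to_unit clamp_id// subrr normr0 => h00; rewrite -h00 ltxx in h0.
Qed.

End unit_cube.

(** * A mean value inequality for vector-valued functions *)

Section mean_value.
Context {R : realType} {X : normedModType R}.

(** Continuous induction: the supremum [x] of the points up to which the estimate from [a] holds
    satisfies it as well, and the local bound at [x] would carry it further if [x < b]. *)
Lemma local_lipschitz_le (phi : R -> X) (M a b : R) : a <= b ->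
  (forall x, a <= x <= b -> exists2 d, 0 < d & forall y, a <= y <= b ->
    `|x - y| < d -> `|phi y - phi x| <= M * `|y - x|) ->
  `|phi b - phi a| <= M * (b - a).
Proof.
move=> ab loc.
pose S := [set s | a <= s <= b /\ `|phi s - phi a| <= M * (s - a)].
have Sa : S a by split; [rewrite lexx|rewrite !subrr normr0 mulr0].
have supS : has_sup S by split; [exists a|exists b => s [/andP[]]].
pose x := sup S.
have ax : a <= x by apply: sup_ubound => //; exact: supS.2.
have xb : x <= b by apply: ge_sup; [exists a|move=> s [/andP[]]].
have [|d d0 dx] := loc x; first by rewrite ax.
have [s Ss xs] := sup_adherent d0 supS; rewrite -/x in xs.
have sx : s <= x by apply: sup_ubound => //; exact: supS.2.
have Sx : S x.
  split; first by rewrite ax.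
  have [/andP[as_ sb] sa] := Ss.
  have := dx s; rewrite as_ sb ger0_norm ?subr_ge0// => /(_ isT).
  rewrite distrC (distrC s) (ger0_norm (_ : 0 <= x - s)) ?subr_ge0// => ds.
  rewrite -[phi x](subrK (phi s)) -addrA (le_trans (ler_normD _ _))//.
  rewrite (_ : x - a = (x - s) + (s - a)); last by ring.
  by rewrite mulrDr lerD// ds//; lra.
have [xltb|] := ltP x b; last first.
  by move=> bx; have -> : b = x; [apply/eqP; rewrite eq_le bx xb|case: Sx].
pose y := Num.min b (x + d / 2).
have xy : x < y by rewrite lt_min xltb ltrDl divr_gt0.
have yb : y <= b by rewrite ge_min lexx.
have yd : y <= x + d / 2 by rewrite ge_min lexx orbT.
have : S y.
  split; first by rewrite yb (le_trans ax)// ltW.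
  have := dx y; rewrite yb (le_trans ax (ltW xy)) => /(_ isT).
  have yx0 : 0 <= y - x by rewrite subr_ge0 ltW.
  rewrite (distrC x) (ger0_norm yx0) => ds.
  have [_ xa] := Sx.
  rewrite -[phi y](subrK (phi x)) -addrA (le_trans (ler_normD _ _))//.
  rewrite (_ : y - a = (y - x) + (x - a)); last by ring.
  by rewrite mulrDr lerD// ds//; lra.
move=> Sy; have : y <= x by apply: sup_ubound => //; exact: supS.2.
by rewrite leNgt xy.
Qed.

End mean_value.

Section surfaces.
Context {R : realType} {X : normedModType R}.
Implicit Types (g h : cube R -> X) (t : cube R) (j k : nat).

Definition gamma_derive k g t : X :=
  if k is j.+1 then partial_derive j g t else g t.

Lemma gamma_seminormE k g :
  gamma_seminorm k g = sup (range (fun t => `|gamma_derive k g t|)).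
Proof. by []. Qed.

Lemma partial_derive_unique j g t (l : X) :
  partial_quotient j g t s @[s --> (t j)^'] --> l ->
  partial_derivable j g t /\ partial_derive j g t = l.
Proof.
move=> gl; split; first by apply/cvg_ex; exists l.
exact: (cvg_lim (@norm_hausdorff _ _) gl).
Qed.

Lemma C1_partial_cvg j g t : C1_surface g ->
  partial_quotient j g t s @[s --> (t j)^'] --> partial_derive j g t.
Proof. by move=> [_ /(_ j)[/(_ t)]]. Qed.

Lemma partial_derivativeP j g t (l : X) :
  partial_quotient j g t s @[s --> (t j)^'] --> l <->
  forall e, 0 < e -> exists2 d : R, 0 < d & forall s : unit_interval R,
    s != t j -> `|\val (t j) - \val s| < d ->
    `|l - partial_quotient j g t s| <= e.
Proof.
split=> [/cvgrPdist_le gl e e0|H].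
  by have /punctured_unitP[d d0 dH] := gl e e0; exists d.
apply/cvgrPdist_le => e /H[d d0 dH].
by apply/punctured_unitP; exists d.
Qed.

Lemma partial_quotientB j g h t s :
  partial_quotient j (g \- h) t s =
  partial_quotient j g t s - partial_quotient j h t s.
Proof.
rewrite /partial_quotient -scalerBr; congr (_ *: _).
by rewrite /= !opprB addrACA [RHS]addrACA; congr (_ + _); exact: addrC.
Qed.

Lemma C1_surfaceB g h : C1_surface g -> C1_surface h ->
  C1_surface (g \- h) /\
  forall k t,
    gamma_derive k (g \- h) t = gamma_derive k g t - gamma_derive k h t.
Proof.
move=> Cg Ch.
have D j t : partial_derivable j (g \- h) t /\
    partial_derive j (g \- h) t = partial_derive j g t - partial_derive j h t.
  apply: partial_derive_unique.
  have -> : partial_quotient j (g \- h) t =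
      (fun s => partial_quotient j g t s - partial_quotient j h t s).
    by apply/funext => s; exact: partial_quotientB.
  by apply: cvgB; exact: C1_partial_cvg.
split; last by move=> [|j] t //=; have [] := D j t.
case: Cg Ch => [cg dg] [ch dh]; split.
  by move=> t; exact: cvgB (cg t) (ch t).
move=> j; split=> [t|]; first by have [] := D j t.
rewrite (_ : partial_derive j (g \- h) =
  partial_derive j g \- partial_derive j h).
  by move=> t; exact: cvgB ((dg j).2 t) ((dh j).2 t).
by apply/funext => t; have [] := D j t.
Qed.

Lemma gamma_derive_continuous k g :
  C1_surface g -> continuous (gamma_derive k g).
Proof. by case: k => [|j] [cg dg]; [exact: cg|exact: (dg j).2]. Qed.

Definition cube0 : cube R := to_cube (fun=> 0).

(** Compactness of the cube makes the seminorms finite, so that the real [sup] defining them is a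
    genuine supremum. *)
Lemma gamma_derive_has_sup k g : C1_surface g ->
  has_sup (range (fun t => `|gamma_derive k g t|)).
Proof.
move=> Cg; split; first by exists `|gamma_derive k g cube0|, cube0.
have : compact (range (fun t => `|gamma_derive k g t|)).
  apply: continuous_compact; last exact: cube_compact.
  apply: continuous_subspaceT => t.
  apply: (@continuous_comp _ _ _ (gamma_derive k g) Num.norm).
    exact: gamma_derive_continuous.
  exact: norm_continuous.
move/compact_bounded => [M [Mreal MP]]; exists (M + 1) => _ [t _ <-].
have MM1 : M < M + 1 by rewrite ltrDl.
have := MP _ MM1 `|gamma_derive k g t| (imageP _ I).
by rewrite /= ger0_norm.
Qed.

Lemma le_gamma_seminorm k g t : C1_surface g ->
  `|gamma_derive k g t| <= gamma_seminorm k g.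
Proof.
move=> Cg; rewrite gamma_seminormE; apply: sup_ubound; last by exists t.
by have [] := gamma_derive_has_sup k Cg.
Qed.

Lemma gamma_seminorm_le k g (M : R) :
  (forall t, `|gamma_derive k g t| <= M) -> gamma_seminorm k g <= M.
Proof.
move=> gM; rewrite gamma_seminormE; apply: ge_sup.
  by exists `|gamma_derive k g cube0|, cube0.
by move=> _ [t _ <-].
Qed.

Lemma gamma_seminorm_ge0 k g : C1_surface g -> 0 <= gamma_seminorm k g.
Proof. by move=> /(@le_gamma_seminorm k g cube0); apply: le_trans. Qed.

Lemma gamma_seminorm_triangle k g1 g2 g3 :
  C1_surface g1 -> C1_surface g2 -> C1_surface g3 ->
  gamma_seminorm k (g1 \- g3) <=
  gamma_seminorm k (g1 \- g2) + gamma_seminorm k (g2 \- g3).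
Proof.
move=> C1 C2 C3; have [C13 E13] := C1_surfaceB C1 C3.
have [C12 E12] := C1_surfaceB C1 C2; have [C23 E23] := C1_surfaceB C2 C3.
apply: gamma_seminorm_le => t; rewrite E13.
rewrite (_ : _ - _ = gamma_derive k (g1 \- g2) t + gamma_derive k (g2 \- g3) t).
  rewrite (le_trans (ler_normD _ _))// lerD//; exact: le_gamma_seminorm.
by rewrite E12 E23 addrA subrK.
Qed.

Lemma dfwith_id t j : dfwith t j (t j) = t.
Proof. by apply/funext => i; case: dfwithP. Qed.

Lemma dfwith_dfwith t j s s' : dfwith (dfwith t j s) j s' = dfwith t j s'.
Proof.
apply/funext => i; have [<-|ji] := eqVneq j i; first by rewrite !dfwithin.
by rewrite !dfwithout.
Qed.

(** On a coordinate line the local slopes are at most the seminorm plus [e'], where [e'] is scaled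
    so that the excess over the whole segment is [e]. *)
Lemma surface_mean_value g t j (s : unit_interval R) : C1_surface g ->
  `|g (dfwith t j s) - g t| <=
  gamma_seminorm j.+1 g * `|\val s - \val (t j)|.
Proof.
move=> Cg.
suff main u (a b : unit_interval R) : \val a <= \val b ->
    `|g (dfwith u j b) - g (dfwith u j a)| <=
    gamma_seminorm j.+1 g * (\val b - \val a).
  rewrite -{2}(dfwith_id t j).
  have [ts|st] := leP (\val (t j)) (\val s).
    by rewrite ger0_norm ?subr_ge0// main.
  by rewrite distrC (distrC (\val s)) gtr0_norm ?subr_gt0// main// ltW.
move=> ab; apply/ler_addgt0Pr => e e0.
have [ba|{}ab] := leP (\val b) (\val a).
  have -> : a = b by apply: val_inj; apply/eqP; rewrite eq_le ab ba.
  by rewrite !subrr normr0 mulr0 add0r ltW.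
pose e' := e / (\val b - \val a).
have ba0 : 0 < (\val b : R) - \val a by rewrite subr_gt0.
have e'0 : 0 < e' by rewrite divr_gt0.
have -> : gamma_seminorm j.+1 g * (\val b - \val a) + e =
    (gamma_seminorm j.+1 g + e') * (\val b - \val a).
  by rewrite mulrDl /e' divfK// gt_eqF.
pose phi (x : R) := g (dfwith u j (to_unit x)).
have phiE (r : unit_interval R) : g (dfwith u j r) = phi (\val r).
  by rewrite /phi to_unitK.
rewrite !phiE; apply: local_lipschitz_le; first exact: ltW.
have /andP[a0 _] := val_unit_itv a; have /andP[_ b1] := val_unit_itv b.
have in01 x : \val a <= x <= \val b -> `[0, 1]%classic x.
  by move=> /andP[ax xb]; rewrite /= in_itv/= (le_trans a0)// (le_trans xb).
move=> x /in01 x01.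
pose w := dfwith u j (to_unit x).
have wj : w j = to_unit x by rewrite /w dfwithin.
have /partial_derivativeP/(_ e' e'0)[d d0 dP] := @C1_partial_cvg j g w Cg.
exists d => // y /in01 y01 xy.
have [->|yx] := eqVneq y x; first by rewrite !subrr !normr0 mulr0.
have := dP (to_unit y); rewrite wj !val_to_unit !clamp_id// => /(_ _ xy) Q.
have {}Q : `|partial_derive j g w - partial_quotient j g w (to_unit y)| <= e'.
  apply: Q; apply/negP => /eqP /(congr1 val).
  by rewrite !val_to_unit !clamp_id// => /eqP; apply/negP.
have {}Q : `|partial_quotient j g w (to_unit y)| <= gamma_seminorm j.+1 g + e'.
  rewrite -[X in `|X|](subrK (partial_derive j g w)) addrC.
  rewrite (le_trans (ler_normD _ _))// lerD//; last by rewrite distrC.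
  exact: (@le_gamma_seminorm j.+1).
move: Q; rewrite /partial_quotient wj !val_to_unit !clamp_id// dfwith_dfwith.
rewrite normrZ normfV ler_pdivrMl ?normr_gt0 ?subr_eq0// mulrC.
by apply: le_trans.
Qed.

End surfaces.

(** * Completeness and the Baire property of the space of surfaces *)

Section completeness.
Context {R : realType} {X : completeNormedModType R}.
Implicit Types (n k j : nat) (t : cube R).

Local Notation r n := ((2^-1 : R) ^+ n).

Lemma half_pow_gt0 n : 0 < r n.
Proof. by rewrite exprn_gt0// invr_gt0. Qed.

Lemma half_pow_small (e : R) k : 0 < e -> exists2 n, (k <= n)%N & 2 * r n < e.
Proof.
move=> e0; have e2 : 0 < e / 2 by rewrite divr_gt0.
have half1 : `|2^-1 : R| < 1 by rewrite ger0_norm ?invr_ge0// invf_lt1// ltr1n.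
have /cvgrPdist_lt/(_ _ e2)[N _ NP] := cvg_expr half1.
exists (maxn k N); first exact: leq_maxl.
have := NP (maxn k N) (leq_maxr k N).
rewrite /= sub0r normrN ger0_norm ?ltW ?half_pow_gt0//.
by rewrite ltr_pdivlMr// mulrC.
Qed.

Lemma geometric_dist (u : nat -> X) k n m :
  (forall n, (k <= n)%N -> `|u n.+1 - u n| <= r n) ->
  (k <= n)%N -> (n <= m)%N -> `|u m - u n| <= 2 * r n.
Proof.
move=> uk kn nm; rewrite -(subnKC nm); elim: (m - n)%N => [|d IH].
  by rewrite addn0 subrr normr0 mulr_ge0// ltW// half_pow_gt0.
(* The exact geometric remainder is kept, since the weaker bound [2 * r n] does not pass through the
   induction. *)
suff main i : `|u (n + i)%N - u n| <= 2 * r n - 2 * r (n + i)%N.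
  by rewrite (le_trans (main d.+1))// gerBl mulr_ge0// ltW// half_pow_gt0.
elim: i => [|i IHi]; first by rewrite addn0 !subrr normr0.
rewrite addnS -[u _](subrK (u (n + i)%N)) -addrA (le_trans (ler_normD _ _))//.
have := uk (n + i)%N (leq_trans kn (leq_addr _ _)).
by rewrite exprS; move: IHi; set x := r _; set y := r _ => *; lra.
Qed.

Lemma geometric_limit (u : nat -> X) k :
  (forall n, (k <= n)%N -> `|u n.+1 - u n| <= r n) ->
  exists l, forall n, (k <= n)%N -> `|l - u n| <= 2 * r n.
Proof.
move=> uk; have : cauchy (u @ \oo).
  apply: cauchy_exP => e e0; have [n kn ne] := half_pow_small k e0.
  exists (u n); exists n => // m /= nm.
  rewrite -ball_normE /= distrC; apply: le_lt_trans ne.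
  exact: geometric_dist uk kn nm.
move/cauchy_cvgP/cvg_ex => [l ul]; exists l => n kn.
apply/ler_addgt0Pr => e e0.
move/cvgrPdist_lt : ul => /(_ _ e0)[N _ NP].
have nm : (n <= maxn n N)%N by exact: leq_maxl.
rewrite -[l](subrK (u (maxn n N))) -addrA (le_trans (ler_normD _ _))// [leLHS]addrC.
rewrite lerD//; first exact: geometric_dist uk kn nm.
by rewrite ltW//; apply: NP; exact: leq_maxr.
Qed.

(** Step [n] controls only the seminorms up to [n], so the derivative of index [k] converges
    uniformly from rank [k] on. Uniform limits are continuous, and the mean value inequality
    identifies the limit of the derivatives with the derivative of the limit. *)
Lemma C1_surface_complete (g : nat -> cube R -> X) :
  (forall n, C1_surface (g n)) ->
  (forall n k, (k <= n)%N -> gamma_seminorm k (g n.+1 \- g n) <= r n) ->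
  exists2 l, C1_surface l &
    forall n k, (k <= n)%N -> gamma_seminorm k (l \- g n) <= 2 * r n.
Proof.
move=> Cg gS.
have inc k t n : (k <= n)%N ->
    `|gamma_derive k (g n.+1) t - gamma_derive k (g n) t| <= r n.
  move=> kn; have [CB E] := C1_surfaceB (Cg n.+1) (Cg n).
  by rewrite -E; apply: le_trans (gS n k kn); exact: le_gamma_seminorm.
have /choice[L0 L0P] : forall k, exists L : cube R -> X, forall t n,
    (k <= n)%N -> `|L t - gamma_derive k (g n) t| <= 2 * r n.
  move=> k; have := fun t => geometric_limit (inc k t).
  by move=> /choice[L LP]; exists L.
have cL k : continuous (L0 k).
  move=> t; apply/(@cvgrPdist_le _ _ (cube R) (nbhs t)) => e e0.
  have e3 : 0 < e / 3 by rewrite divr_gt0.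
  have [n kn ne] := half_pow_small k e3.
  have /(@cvgrPdist_le _ _ (cube R) (nbhs t))/(_ _ e3) :=
    @gamma_derive_continuous _ _ k (g n) (Cg n) t.
  apply: filterS => t' tt'.
  have := L0P k t n kn; have := L0P k t' n kn.
  set a := L0 k t; set b := L0 k t'; move: tt'.
  set c := gamma_derive k _ t; set d := gamma_derive k _ t' => cd bd ac.
  rewrite (_ : a - b = (a - c) + (c - d) + (d - b)); last first.
    by rewrite !addrA !subrK.
  rewrite (le_trans (ler_normD _ _))// (distrC d).
  have := ler_normD (a - c) (c - d); lra.
have dL j t : partial_quotient j (L0 0%N) t s @[s --> (t j)^'] --> L0 j.+1 t.
  apply/partial_derivativeP => e e0.
  have e3 : 0 < e / 3 by rewrite divr_gt0.
  have [n jn ne] := half_pow_small j.+1 e3.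
  have /partial_derivativeP/(_ _ e3)[d d0 dP] := @C1_partial_cvg _ _ j (g n) t (Cg n).
  exists d => // s st sd.
  have h1 := L0P j.+1 t n jn; have {dP}h2 := dP s st sd.
  (* This comparison is uniform in [s]: apply the mean value inequality to [g m \- g n], then let
     [m] grow, the two end values of the limit being approached within [e' / 2]. *)
  suff h3 : `|partial_quotient j (g n) t s - partial_quotient j (L0 0%N) t s| <=
      2 * r n.
    move: h1 h2 h3 => /=; set a := L0 _ _; set b := partial_derive _ _ _.
    set c := partial_quotient _ _ _ _; set f := partial_quotient _ _ _ _ => h1 h2 h3.
    rewrite (_ : a - f = (a - b) + (b - c) + (c - f)); last first.
      by rewrite !addrA !subrK.
    rewrite (le_trans (ler_normD _ _))//.
    have := ler_normD (a - b) (b - c); lra.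
  have x0 : 0 < `|\val s - \val (t j)|.
    rewrite normr_gt0 subr_eq0; apply: contra st => /eqP st.
    by apply/eqP; apply: val_inj.
  rewrite -scalerBr normrZ normfV ler_pdivrMl// [leRHS]mulrC.
  apply/ler_addgt0Pr => e' e'0.
  have [m nm me] := half_pow_small n (divr_gt0 e'0 (ltr0n R 2)).
  have mv := @surface_mean_value _ _ (g m \- g n) t j s (C1_surfaceB (Cg m) (Cg n)).1.
  have sn : gamma_seminorm j.+1 (g m \- g n) <= 2 * r n.
    apply: gamma_seminorm_le => u; rewrite (C1_surfaceB (Cg m) (Cg n)).2.
    exact: (geometric_dist (u := fun n => gamma_derive j.+1 (g n) u) (inc _ _)).
  have {sn}mv : `|(g m \- g n) (dfwith t j s) - (g m \- g n) t| <=
      2 * r n * `|\val s - \val (t j)|.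
    by apply: (le_trans mv); rewrite ler_wpM2r.
  have m1 := L0P 0%N (dfwith t j s) m (leq0n _).
  have m2 := L0P 0%N t m (leq0n _).
  move: mv m1 m2 => /=.
  set a := g m _; set b := g n _; set c := g m _; set d' := g n _.
  set p := L0 _ _; set q := L0 _ _ => mv m1 m2.
  have -> : b - d' - (p - q) = ((b - a) + (c - d')) + ((a - p) + (q - c)).
    rewrite [RHS]addrACA [b - a + _]addrA subrK [c - d' + _]addrC.
    rewrite [q - c + _]addrA subrK opprB [LHS]addrACA [RHS]addrACA.
    by congr (_ + _); exact: addrC.
  move: mv; rewrite -normrN opprB opprB addrC => mv.
  rewrite (le_trans (ler_normD _ _))// lerD//.
  rewrite (le_trans (ler_normD _ _))// (distrC a).
  by move: m1 m2; lra.
have D j t := partial_derive_unique (dL j t).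
have CL : C1_surface (L0 0%N).
  split; first exact: cL.
  move=> j; split=> [u|]; first by have [] := D j u.
  rewrite (_ : partial_derive j _ = L0 j.+1); first exact: cL.
  by apply/funext => u; have [] := D j u.
exists (L0 0%N) => // n k kn; apply: gamma_seminorm_le => t.
rewrite (C1_surfaceB CL (Cg n)).2 (_ : gamma_derive k _ t = L0 k t); first exact: L0P.
by case: k kn => [//|j] _; have [] := D j t.
Qed.

Implicit Types (g h : gamma_space X).

Lemma gamma_funP g : C1_surface (gamma_fun g).
Proof. exact: set_valP. Qed.

Definition gamma_dist k g h : R := gamma_seminorm k (gamma_fun h \- gamma_fun g).

Lemma gamma_dist_triangle k f g h :
  gamma_dist k f h <= gamma_dist k f g + gamma_dist k g h.
Proof.
by rewrite addrC; apply: gamma_seminorm_triangle; exact: gamma_funP.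
Qed.

Lemma gamma_dist_refl k g : gamma_dist k g g = 0.
Proof.
apply/eqP; rewrite eq_le; apply/andP; split.
  apply: gamma_seminorm_le => t.
  by rewrite (C1_surfaceB (gamma_funP g) (gamma_funP g)).2 subrr normr0.
by apply: gamma_seminorm_ge0; have [] := C1_surfaceB (gamma_funP g) (gamma_funP g).
Qed.

Definition gamma_ball g n (e : R) : set (gamma_space X) :=
  [set h | forall k, (k <= n)%N -> gamma_dist k g h < e].

(** The common slack in finitely many strict inequalities; it is the radius used to show that
    [gamma_ball] is open. *)
Lemma uniform_gap (a : nat -> R) n (e : R) :
  (forall k, (k <= n)%N -> a k < e) ->
  exists2 d, 0 < d & forall k, (k <= n)%N -> a k + d <= e.
Proof.
elim: n => [|n IH] ae.
  exists (e - a 0%N); first by rewrite subr_gt0 ae.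
  by move=> k; rewrite leqn0 => /eqP ->; rewrite addrCA subrr addr0.
have [k kn|d d0 dP] := IH; first by apply: ae; rewrite ltnW.
have an : 0 < e - a n.+1 by rewrite subr_gt0 ae.
exists (Num.min d (e - a n.+1)); first by rewrite lt_min d0.
move=> k; rewrite leq_eqVlt => /predU1P[->|kn].
  by rewrite addrC -lerBrDr ge_min lexx orbT.
by rewrite (le_trans _ (dP k kn))// lerD2l ge_min lexx.
Qed.

Lemma gamma_ball_open g n e : open (gamma_ball g n e).
Proof.
have -> : open (gamma_ball g n e) = gamma_open (gamma_ball g n e) by [].
move=> h gh; have [d d0 dP] := uniform_gap gh.
exists n, d; split => // f hf k kn.
apply: le_lt_trans (gamma_dist_triangle k g h f) _.
by apply: lt_le_trans (dP k kn); rewrite ltrD2l hf.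
Qed.

(** Nested closed balls, the [n]-th of radius at most [r n] for at least the seminorms up to [n];
    their centres then satisfy the hypothesis of [C1_surface_complete]. *)
Lemma gamma_baire (U : set (gamma_space X))
    (O : nat -> set (gamma_space X)) :
  open U -> U !=set0 -> (forall i, open (O i) /\ dense (O i)) ->
  exists2 g, U g & forall i, O i g.
Proof.
move=> oU U0 Od.
pose cball g n (e : R) : set (gamma_space X) :=
  [set h | forall k, (k <= n)%N -> gamma_dist k g h <= e].
have shrink (V : set (gamma_space X)) g n : open V -> V g ->
    exists N e, [/\ (n <= N)%N, 0 < e, e <= r n & cball g N e `<=` V].
  move=> oV Vg; have [N [e [e0 eV]]] : exists (n : nat) (e : R), 0 < e /\
    forall h : gamma_space X, (forall k, (k <= n)%N -> gamma_dist k g h < e) -> V h.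
    exact: (oV g Vg).
  exists (maxn n N), (Num.min (e / 2) (r n)); split.
  - exact: leq_maxl.
  - by rewrite lt_min half_pow_gt0 divr_gt0.
  - by rewrite ge_min lexx orbT.
  - move=> h hP; apply: eV => k kN.
    rewrite (le_lt_trans (hP k _))//; first by rewrite (leq_trans kN)// leq_maxr.
    by rewrite gt_min; apply/orP; left; lra.
(* A ball is coded by its centre, its number of seminorms and its radius. Positivity of the radius
   is a premise inside the existential, so that [choice] yields a function on all triples. *)
have step n (p : gamma_space X * nat * R) : exists q : gamma_space X * nat * R,
    0 < p.2 -> [/\ (n < q.1.2)%N, 0 < q.2, q.2 <= r n.+1 &
      cball q.1.1 q.1.2 q.2 `<=` O n `&` gamma_ball p.1.1 p.1.2 p.2].
  have [p0|] := pselect (0 < p.2); last by exists p.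
  have ball0 : gamma_ball p.1.1 p.1.2 p.2 !=set0.
    by exists p.1.1 => k _; rewrite gamma_dist_refl.
  have [h [Bh Oh]] := (Od n).2 _ ball0 (@gamma_ball_open _ _ _).
  have [N [e [nN e0 er eO]]] := shrink _ h n.+1
    (openI (Od n).1 (@gamma_ball_open p.1.1 p.1.2 p.2)) (conj Oh Bh).
  by exists (h, N, e).
pose F n := projT1 (choice (step n)); pose FP n := projT2 (choice (step n)).
have [g0 Ug0] := U0; have [N0 [e0 [_ e00 er0 eU]]] := shrink U g0 0%N oU Ug0.
pose fix S n := if n is n'.+1 then F n' (S n') else (g0, N0, e0).
have S0 n : 0 < (S n).2.
  by elim: n => [//|n IH] /=; have [] := FP n (S n) IH.
have SN n : (n <= (S n).1.2)%N.
  by case: n => [//|n] /=; have [] := FP n (S n) (S0 n).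
have Sr n : (S n).2 <= r n.
  by case: n => [//|n] /=; have [] := FP n (S n) (S0 n).
pose C n := cball (S n).1.1 (S n).1.2 (S n).2.
have CS n : C n.+1 `<=` O n `&` C n.
  have [_ _ _ h] := FP n (S n) (S0 n).
  by move=> f /h[Of Bf]; split => // k kn; exact/ltW/Bf.
have Cmono n m : (n <= m)%N -> C m `<=` C n.
  move=> nm; rewrite -(subnKC nm); elim: (m - n)%N => [|d IH]; first by rewrite addn0.
  by rewrite addnS; apply: subset_trans IH => f /CS[].
have Cc n : C n (S n).1.1 by move=> k _; rewrite gamma_dist_refl ltW.
have [l Cl lP] := @C1_surface_complete (fun n => gamma_fun (S n).1.1)
  (fun n => gamma_funP _)
  (fun n k kn => le_trans (Cmono n n.+1 (leqnSn n) _ (Cc n.+1) k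
     (leq_trans kn (SN n))) (Sr n)).
pose f : gamma_space X := exist _ l (mem_set Cl).
(* Later centres lie in [C n] and approach [f]; the closed inequality passes to the limit. *)
have fC n : C n f.
  move=> k kn; apply/ler_addgt0Pr => e e_0.
  have [m nm me] := half_pow_small (maxn n k) e_0.
  have knm : (k <= m)%N by rewrite (leq_trans _ nm)// leq_maxr.
  rewrite (le_trans (gamma_dist_triangle k _ (S m).1.1 _))// lerD//.
    by apply: (Cmono n m) => //; rewrite (leq_trans _ nm)// leq_maxl.
  by rewrite (le_trans (lP m k knm))// ltW.
exists f; first exact: (eU _ (fC 0%N)).
by move=> i; have [] := CS i f (fC i.+1).
Qed.

End completeness.

(** * Lipschitz maps along surfaces *)

Section derivatives_of_lipschitz.
Context {R : realType} {X Y : normedModType R}.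

Lemma lipschitz_const (G : set X) (f : X -> Y) :
  [lipschitz f x | x in G] ->
  exists2 k : R, 0 < k &
    forall x y, G x -> G y -> `|f x - f y| <= k * `|x - y|.
Proof.
move=> [M [_ MP]]; exists (Num.max 0 M + 1).
  by rewrite ltr_wpDl// le_max lexx.
move=> x y Gx Gy; apply: (MP (Num.max 0 M + 1) _ (x, y)); last by split.
by rewrite (@le_lt_trans _ _ (Num.max 0 M))// ?ltrDl// le_max lexx orbT.
Qed.

Lemma linear_norm_bound (y : {linear X -> R^o}) : continuous y ->
  exists2 C : R, 0 <= C & forall x, `|y x : R| <= C * `|x|.
Proof.
move=> cy; have /continuous_linear_bounded/linear_boundedP := cy 0.
case=> M [_ MP]; exists (Num.max 0 M + 1).
  by rewrite addr_ge0// le_max lexx.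
apply: (MP (Num.max 0 M + 1)).
by rewrite (@le_lt_trans _ _ (Num.max 0 M))// ?ltrDl// le_max lexx orbT.
Qed.

Lemma linear_norm_bounds (I : Type) (y : I -> {linear X -> R^o}) :
  (forall i, continuous (y i)) ->
  exists C : I -> R,
    forall i, 0 <= C i /\ forall x, `|y i x : R| <= C i * `|x|.
Proof.
move=> cy; have H i : exists C : R, 0 <= C /\
    forall x, `|y i x : R| <= C * `|x|.
  by have [C C0 CP] := linear_norm_bound (cy i); exists C.
by have [C CP] := choice H; exists C.
Qed.

Lemma is_derive_cvg (f : X -> Y) (x u : X) (l : Y) : is_derive x u f l ->
  h^-1 *: (f (h *: u + x) - f x) @[h --> (0 : R)^'] --> l.
Proof. by move=> [d <-]; exact: d. Qed.

Lemma is_derive_norm_le (G : set X) (f : X -> Y) (k : R) (x u : X) (l : Y) :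
  open G -> G x -> (forall x y, G x -> G y -> `|f x - f y| <= k * `|x - y|) ->
  is_derive x u f l -> `|l| <= k * `|u|.
Proof.
move=> oG Gx fk /is_derive_cvg fl.
apply/ler_addgt0Pr => e e0.
have Gh : \forall h \near (0 : R)^', G (h *: u + x).
  have ch : (h *: u + x) @[h --> (0 : R)^'] --> x.
    rewrite -[X in _ --> X]add0r -(scale0r u).
    apply: cvgD; last exact: cvg_cst.
    by apply: cvgZr_tmp; exact: nbhs_dnbhs.
  by apply: ch; exact: open_nbhs_nbhs.
near (0 : R)^' => h.
have h0 : h != 0 by near: h; exact: nbhs_dnbhs_neq.
have lh : `|l - h^-1 *: (f (h *: u + x) - f x)| <= e.
  by near: h; move/cvgrPdist_le : fl; apply.
rewrite -[l](subrK (h^-1 *: (f (h *: u + x) - f x))).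
rewrite (le_trans (ler_normD _ _))// addrC lerD//.
rewrite normrZ normfV ler_pdivrMl ?normr_gt0//.
have Ghx : G (h *: u + x) by near: h.
by rewrite (le_trans (fk _ _ Ghx Gx))// addrK normrZ mulrCA.
Unshelve. all: by end_near. Qed.

Lemma differentiable_gateaux (f : X -> Y) (x : X) : differentiable f x ->
  is_gateaux_derivative f x ('d f x).
Proof.
move=> df; split; first exact: diff_continuous.
by move=> u; split; [exact: diff_derivable|exact: deriveE].
Qed.

Lemma differentiable_expansion (f : X -> Y) (x : X) (e : R) :
  differentiable f x -> 0 < e ->
  exists2 d : R, 0 < d & forall w, `|w| < d ->
    `|f (x + w) - f x - 'd f x w| <= e * `|w|.
Proof.
move=> df e0; have := diff_locally df => /eqaddoP /(_ e e0) /nbhs_ballP[d d0 dP].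
exists d => // w wd; have := dP w; rewrite -ball_normE /= sub0r normrN => /(_ wd).
by rewrite /= /shift/= !fctE opprD addrA (addrC w).
Qed.

(** A chain rule along sequences. The increments [w n] follow a surface, so their direction varies
    with [n]; the uniform remainder of Frechet differentiability absorbs this. *)
Lemma differentiable_path_cvg (f : X -> Y) (x p : X) (w : nat -> X)
    (a : nat -> R) :
  differentiable f x -> (forall n, 0 < a n) -> a n @[n --> \oo] --> 0 ->
  (a n)^-1 *: w n @[n --> \oo] --> p ->
  (a n)^-1 *: (f (x + w n) - f x) @[n --> \oo] --> 'd f x p.
Proof.
move=> df a0 acvg wp.
have w0 : w n @[n --> \oo] --> 0.
  rewrite (_ : w = fun n => a n *: ((a n)^-1 *: w n)).
    by rewrite -(scale0r p); exact: cvgZ.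
  by apply/funext => n; rewrite scalerA divff ?scale1r// gt_eqF.
have dw : 'd f x ((a n)^-1 *: w n) @[n --> \oo] --> 'd f x p.
  have cd : continuous ('d f x) by exact: diff_continuous.
  by apply: (cvg_comp (fun n => (a n)^-1 *: w n) ('d f x) wp); exact: cd.
apply/cvgrPdist_le => e e0.
have e2 : 0 < e / 2 by rewrite divr_gt0.
(* Eventually bounds the rescaled increments, so a remainder of slope [e / 2 / q] costs at most
   [e / 2]. *)
pose q := `|p| + 1.
have q0 : 0 < q by rewrite ltr_wpDl.
have [d d0 dP] := differentiable_expansion df (divr_gt0 e2 q0).
near=> n.
have wd : `|w n| < d.
  near: n; move/cvgrPdist_lt : w0 => /(_ _ d0); apply: filterS => n.
  by rewrite sub0r normrN.
have h1 : `|'d f x p - 'd f x ((a n)^-1 *: w n)| <= e / 2.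
  by near: n; move/cvgrPdist_le : dw; apply.
have h2 : `|p - (a n)^-1 *: w n| <= 1.
  by near: n; move/cvgrPdist_le : wp; apply.
have h3 : `|(a n)^-1 *: w n| <= q.
  rewrite -[X in `|X|](subrK p) (le_trans (ler_normD _ _))// addrC lerD//.
  by rewrite distrC.
rewrite (_ : _ - _ = ('d f x p - 'd f x ((a n)^-1 *: w n)) -
    (a n)^-1 *: (f (x + w n) - f x - 'd f x (w n))); last first.
  have -> : 'd f x ((a n)^-1 *: w n) = (a n)^-1 *: 'd f x (w n) by rewrite linearZ.
  move: (f (x + w n) - f x) ('d f x (w n)) => z1 z2.
  by rewrite scalerBr [- (_ - (a n)^-1 *: z2)]opprB addrA subrK.
rewrite (le_trans (ler_normB _ _))// (splitr e) lerD// normrZ.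
have an : 0 < (a n)^-1 by rewrite invr_gt0.
rewrite (gtr0_norm an).
apply: (@le_trans _ _ ((a n)^-1 * (e / 2 / q * `|w n|))).
  by apply: ler_wpM2l; [exact: ltW|exact: dP].
move: h3; rewrite normrZ (gtr0_norm an) => h3.
rewrite mulrCA -[leRHS](divfK (lt0r_neq0 q0)) ler_wpM2l// ltW// divr_gt0//.
Unshelve. all: by end_near. Qed.

End derivatives_of_lipschitz.

(** * Affine surfaces and the expansion at a point of Gateaux differentiability *)

Section affine_surface.
Context {R : realType} {X : normedModType R}.
Variables (m : nat) (v : 'I_m -> X).

Definition centered_sum (t : cube R) : X :=
  \sum_(i < m) ((\val (t i) : R) - 2^-1) *: v i.

Definition affine_surface (x0 : X) (r : R) (t : cube R) : X :=
  x0 + r *: centered_sum t.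

(** Extends [v] by 0, since partial derivatives are taken in every coordinate and the surface
    depends on the first [m] only. *)
Definition direction (j : nat) : X := if insub j is Some i then v i else 0.

Lemma direction_ord (i : 'I_m) : direction i = v i.
Proof. by rewrite /direction valK. Qed.

Lemma centered_sum_update t j s :
  centered_sum (dfwith t j s) - centered_sum t =
  ((\val s : R) - \val (t j)) *: direction j.
Proof.
rewrite /centered_sum -sumrB /direction; case: insubP => [i _ ij|nj].
  rewrite (bigD1 i)//= big1 ?addr0 => [|k ki].
    rewrite -scalerBl -ij dfwithin; congr (_ *: _).
    by ring.
  rewrite dfwithout ?subrr// -ij; apply: contra ki => /eqP ki.
  by apply/eqP/val_inj.
rewrite big1 ?scaler0// => k _; rewrite dfwithout ?subrr//.
by apply: contra nj => /eqP ->.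
Qed.

Lemma centered_sum_continuous : continuous centered_sum.
Proof.
move=> t; rewrite /centered_sum.
have Ft : Filter (nbhs t) := nbhs_filter t.
apply: cvg_big => [|i _]; first exact: add_continuous.
apply: cvgZr_tmp.
apply: cvgB; last exact: cvg_cst.
apply: (@continuous_comp _ _ _ (fun t : cube R => t i)
  (fun s : unit_interval R => \val s : R)).
  exact: cube_proj_continuous.
exact: unit_val_continuous.
Qed.

Lemma affine_surface_update x0 r t j s :
  affine_surface x0 r (dfwith t j s) - affine_surface x0 r t =
  ((\val s : R) - \val (t j)) *: (r *: direction j).
Proof.
rewrite /affine_surface opprD addrACA subrr add0r -scalerBr.
by rewrite centered_sum_update scalerA mulrC -scalerA.
Qed.

Lemma affine_surface_C1 x0 r : C1_surface (affine_surface x0 r) /\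
  forall j t, partial_derive j (affine_surface x0 r) t = r *: direction j.
Proof.
have D j t : partial_derivable j (affine_surface x0 r) t /\
    partial_derive j (affine_surface x0 r) t = r *: direction j.
  apply: partial_derive_unique; apply/partial_derivativeP => e e0.
  exists 1 => // s st _; rewrite /partial_quotient affine_surface_update.
  rewrite (scalerA (_^-1)) mulVf ?scale1r ?subrr ?normr0 ?ltW//.
  rewrite subr_eq0; apply: contra st => /eqP st.
  by apply/eqP; apply: val_inj.
split; last by move=> j t; have [] := D j t.
split.
  move=> t; have Ft : Filter (nbhs t) := nbhs_filter t.
  apply: cvgD; first exact: cvg_cst.
  by apply: cvgZl_tmp; exact: centered_sum_continuous.
move=> j; split=> [t|]; first by have [] := D j t.
rewrite (_ : partial_derive j _ = fun=> r *: direction j).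
  exact: cst_continuous.
by apply/funext => t; have [] := D j t.
Qed.

End affine_surface.

Section uniform_gateaux.
Context {R : realType} {X Y : normedModType R}.
Variables (m : nat) (v : 'I_m -> X).

(* Compactness of the set of directions upgrades the Gateaux derivative of a
   Lipschitz map to a first-order expansion which is uniform on the surface. *)
Lemma gateaux_uniform (G : set X) (f : X -> Y) (k rho e : R) (x0 : X)
    (L : {linear X -> Y}) :
  0 < k -> (forall x y, G x -> G y -> `|f x - f y| <= k * `|x - y|) ->
  0 < rho -> (forall x, `|x - x0| < rho -> G x) ->
  is_gateaux_derivative f x0 L -> 0 < e ->
  exists2 r : R, 0 < r & forall t,
    `|affine_surface v x0 r t - x0| < rho /\
    `|f (affine_surface v x0 r t) - f x0 - r *: L (centered_sum v t)| <= e * r.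
Proof.
move=> k0 fk rho0 Grho [cL dL] e0.
pose P (r : R) (t : cube R) := 0 < r -> 
  `|affine_surface v x0 r t - x0| < rho /\
  `|f (affine_surface v x0 r t) - f x0 - r *: L (centered_sum v t)| <= e * r.
suff : \forall r \near (0 : R)^'+, [set: cube R] `<=` P r.
  move=> H; near (0 : R)^'+ => r; exists r; first by near: r; exact: nbhs_right_gt.
  move=> t; have : P r t by move: t I; near: r; exact: H.
  by apply; near: r; exact: nbhs_right_gt.
(* By compactness it suffices to treat parameters close to a fixed [t] and small [r] jointly, which
   involves the Gateaux limit in the single direction [d] only. *)
have /compact_near_coveringP := @cube_compact R; apply => t _.
pose d := centered_sum v t.
have e3 : 0 < e / 3 by rewrite divr_gt0.
(* Turning the direction by [dl] changes [f] by at most [k * r * dl], within [e / 3 * r], and moves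
   the point by less than [rho / 2] when [r < 1]. *)
pose dl := Num.min (e / 3 / k) (rho / 2).
have dl0 : 0 < dl by rewrite lt_min !divr_gt0.
have near_t : \forall u \near t, `|centered_sum v u - d| <= dl /\
    `|L (centered_sum v u) - L d| <= e / 3.
  have Ft : Filter (nbhs t) := nbhs_filter t.
  have c1 := @centered_sum_continuous _ _ _ v t.
  have c2 : L (centered_sum v u) @[u --> t] --> L d.
    exact: (cvg_comp _ _ c1 (cL d)).
  have n1 : \forall u \near t, `|d - centered_sum v u| <= dl.
    by move/(@cvgrPdist_le _ _ _ (nbhs t)) : c1; apply.
  have n2 : \forall u \near t, `|L d - L (centered_sum v u)| <= e / 3.
    by move/(@cvgrPdist_le _ _ _ (nbhs t)) : c2; apply.
  by apply: filterS2 n1 n2 => u; rewrite distrC => ? ; rewrite distrC.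
have near_r : \forall r \near (0 : R)^'+, [/\ 0 < r, r < 1, r * `|d| < rho / 2 &
    `|L d - r^-1 *: (f (r *: d + x0) - f x0)| <= e / 3].
  have n1 : \forall r \near (0 : R)^'+, 0 < r by exact: nbhs_right_gt.
  have n2 : \forall r \near (0 : R)^'+, r < 1 by exact: nbhs_right_lt.
  have d1 : 0 < `|d| + 1 by rewrite ltr_wpDl.
  have n3 : \forall r \near (0 : R)^'+, r < rho / 2 / (`|d| + 1).
    by apply: nbhs_right_lt; rewrite !divr_gt0.
  have n4 : \forall r \near (0 : R)^'+,
      `|L d - r^-1 *: (f (r *: d + x0) - f x0)| <= e / 3.
    have /cvgrPdist_le/(_ _ e3) := is_derive_cvg (dL d).
    rewrite !near_withinE; apply: filterS => r H r0; apply: H.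
    by rewrite gt_eqF.
  near=> r; have r0 : 0 < r by near: r.
  have r1 : r < 1 by near: r.
  have r4 : `|L d - r^-1 *: (f (r *: d + x0) - f x0)| <= e / 3 by near: r.
  split => //.
  have : r < rho / 2 / (`|d| + 1) by near: r.
  rewrite ltr_pdivlMr//; apply: le_lt_trans.
  by apply: ler_wpM2l; [exact: ltW|rewrite lerDl].
exists ([set u | `|centered_sum v u - d| <= dl /\
    `|L (centered_sum v u) - L d| <= e / 3],
  [set r : R | [/\ 0 < r, r < 1, r * `|d| < rho / 2 &
    `|L d - r^-1 *: (f (r *: d + x0) - f x0)| <= e / 3]]) => //=.
move=> [u r] /= [[udl Lud] [r0 r1 rd fd]] _.
pose w := centered_sum v u; rewrite -/w in udl Lud *.
have dlr : dl <= rho / 2 by rewrite ge_min lexx orbT.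
have dle : dl <= e / 3 / k by rewrite ge_min lexx.
have wd : `|r *: w - r *: d| <= r * dl.
  by rewrite -scalerBr normrZ gtr0_norm//; apply: ler_wpM2l => //; exact: ltW.
have Bw : `|r *: w| < rho.
  rewrite -[r *: w](subrK (r *: d)) (le_lt_trans (ler_normD _ _))//.
  rewrite (splitr rho) ler_ltD//; last by rewrite normrZ gtr0_norm.
  apply: (le_trans wd); apply: le_trans dlr.
  by rewrite ger_pMl//; exact: ltW.
have AE : affine_surface v x0 r u = x0 + r *: w by [].
split; first by rewrite AE addrAC subrr add0r.
have Gw : G (x0 + r *: w) by apply: Grho; rewrite addrAC subrr add0r.
have Gd : G (x0 + r *: d).
  apply: Grho; rewrite addrAC subrr add0r normrZ gtr0_norm//.
  by apply: (lt_le_trans rd); lra.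
(* Three errors of [e / 3 * r]: the Lipschitz bound, the Gateaux expansion in direction [d], the
   continuity of [L]. *)
have h1 : `|f (x0 + r *: w) - f (x0 + r *: d)| <= e / 3 * r.
  rewrite (le_trans (fk _ _ Gw Gd))// opprD addrACA subrr add0r.
  rewrite (@le_trans _ _ (k * (r * dl)))//; first by apply: ler_wpM2l => //; exact: ltW.
  rewrite mulrCA mulrC; apply: ler_wpM2r; first exact: ltW.
  by rewrite mulrC -ler_pdivlMr.
have h2 : `|f (x0 + r *: d) - f x0 - r *: L d| <= e / 3 * r.
  rewrite (_ : _ - _ = - (r *: (L d - r^-1 *: (f (r *: d + x0) - f x0)))).
    rewrite normrN normrZ gtr0_norm// mulrC.
    by apply: ler_wpM2r => //; exact: ltW.
  rewrite (addrC x0 (r *: d)); move: (f _ - f x0) => z.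
  by rewrite scalerBr scalerA divff ?gt_eqF// scale1r opprB.
have h3 : `|r *: L d - r *: L w| <= e / 3 * r.
  rewrite -scalerBr normrZ gtr0_norm// mulrC distrC.
  by apply: ler_wpM2r => //; exact: ltW.
rewrite AE (_ : _ - _ = (f (x0 + r *: w) - f (x0 + r *: d)) +
  (f (x0 + r *: d) - f x0 - r *: L d) + (r *: L d - r *: L w)); last first.
  by rewrite !addrA !subrK.
rewrite (le_trans (ler_normD _ _))//.
have := ler_normD (f (x0 + r *: w) - f (x0 + r *: d)) (f (x0 + r *: d) - f x0 - r *: L d).
lra.
Unshelve. all: by end_near. Qed.

End uniform_gateaux.

(** * Generic surfaces and the points found on them *)

Section generic_surface.
Context {R : realType} {X : completeNormedModType R}.

(** The two sequences of dense open sets are intersected term by term, so that one use of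
    [gamma_baire] inside a ball around [g0] serves both null sets. *)
Lemma generic_surface (N1 N2 : set X) (g0 : gamma_space X) (n : nat) (e : R) :
  residual [set g : gamma_space X |
    product_lebesgue (gamma_fun g @^-1` N1) = 0%E] ->
  residual [set g : gamma_space X |
    product_lebesgue (gamma_fun g @^-1` N2) = 0%E] ->
  0 < e ->
  exists2 g : gamma_space X, (forall k, (k <= n)%N -> gamma_dist k g0 g < e) &
    product_lebesgue (gamma_fun g @^-1` N1 `|` gamma_fun g @^-1` N2) = 0%E.
Proof.
move=> [_ [F1 oF1 ->] F1N] [_ [F2 oF2 ->] F2N] e0.
have Od i : open (F1 i `&` F2 i) /\ dense (F1 i `&` F2 i).
  have [op1 de1] := oF1 i; have [op2 de2] := oF2 i.
  by split; [exact: openI|exact: denseI].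
have [|g Ug gO] := gamma_baire (@gamma_ball_open _ _ g0 n e) _ Od.
  by exists g0 => k _; rewrite gamma_dist_refl.
exists g => //; apply: product_lebesgue0U.
  by apply: F1N => i _; have [] := gO i.
by apply: F2N => i _; have [] := gO i.
Qed.

End generic_surface.

Section slice_points.
Context {R : realType} {X Y : completeNormedModType R}.
Local Notation D := (`[0%R, 1%R[%classic : set R).
Local Notation a n := (harmonic n : R).

(** Here the end point 1 missing from [D] matters: once [a n < 1 - t i], the forward step stays in
    [0, 1] and [to_unit] leaves it unchanged. *)
Lemma surface_increment_cvg (g : cube R -> X) (t : nat -> R) (i : nat) :
  C1_surface g -> D (t i) ->
  (a n)^-1 *: (g (to_cube (update t i (t i + a n))) - g (to_cube t))
    @[n --> \oo] --> partial_derive i g (to_cube t).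
Proof.
move=> Cg; rewrite /= in_itv/= => /andP[ti0 ti1].
have ti01 : `[0, 1]%classic (t i) by rewrite /= in_itv/= ti0 ltW.
have a0 n : 0 < a n by rewrite /harmonic invr_gt0.
apply/cvgrPdist_le => e e0.
have /partial_derivativeP/(_ _ e0)[d d0 dP] :=
  @C1_partial_cvg _ _ i g (to_cube t) Cg.
have hd : 0 < Num.min d (1 - t i) by rewrite lt_min d0 subr_gt0.
have /cvgrPdist_lt/(_ _ hd) := @cvg_harmonic R.
apply: filterS => n; rewrite sub0r normrN (gtr0_norm (a0 n)) lt_min.
move=> /andP[ad at1].
have tn01 : `[0, 1]%classic (t i + a n).
  rewrite /= in_itv/=; apply/andP; split; last by rewrite -lerBrDl ltW.
  by apply: addr_ge0 => //; exact: ltW.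
have valn : \val (to_unit (t i + a n)) = t i + a n.
  by rewrite val_to_unit clamp_id.
have vali : \val (to_cube t i) = t i by rewrite /to_cube val_to_unit clamp_id.
have := dP (to_unit (t i + a n)); rewrite valn vali.
rewrite opprD addrA subrr sub0r normrN (gtr0_norm (a0 n)) => H.
have {H} := H _ ad.
rewrite /partial_quotient valn vali addrAC subrr add0r to_cube_update; apply.
apply/negP => /eqP /(congr1 val); rewrite valn vali => /eqP.
by rewrite -subr_eq0 addrAC subrr add0r gt_eqF.
Qed.

(** The constants multiply along the composition: [C] for [y], [k] for [f], the seminorm of index
    [j.+1] for [g] along coordinate [j], and 1 for [clamp]. *)
Lemma regular_functional_surface (G : set X) (f : X -> Y) (k C rho : R)
    (y : {linear Y -> R^o}) (g : cube R -> X) (x0 : X) :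
  0 < k -> (forall x y, G x -> G y -> `|f x - f y| <= k * `|x - y|) ->
  G x0 -> 0 <= C -> (forall z, `|y z : R| <= C * `|z|) -> C1_surface g ->
  (forall t, G (g t) /\ `|g t - x0| <= rho) ->
  regular (C * (`|f x0| + k * rho)) (fun j => C * (k * gamma_seminorm j.+1 g))
    (fun t => y (f (g (to_cube t)))).
Proof.
move=> k0 fk Gx0 C0 yC Cg gG; split=> [t|j t s s'].
  rewrite (le_trans (yC _))//; apply: ler_wpM2l => //.
  have [Ggt grho] := gG (to_cube t).
  rewrite -[f _](subrK (f x0)) (le_trans (ler_normD _ _))// addrC lerD2l.
  rewrite (le_trans (fk _ _ Ggt Gx0))//.
  by apply: ler_wpM2l => //; exact: ltW.
rewrite -linearB (le_trans (yC _))// -!mulrA; apply: ler_wpM2l => //.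
rewrite (le_trans (fk _ _ (gG _).1 (gG _).1))//.
apply: ler_wpM2l; first exact: ltW.
rewrite -(update_update t j s' s) (to_cube_update _ j s).
rewrite (le_trans (surface_mean_value _ _ _ Cg))//.
apply: ler_wpM2l; first exact: gamma_seminorm_ge0.
by rewrite /to_cube update_same !val_to_unit clamp_lipschitz.
Qed.

(** Supplies a Gateaux derivative, so that the supremum defining a slice is over a nonempty set. It
    is the case of no directions: a generic perturbation of the constant surface [x0], with empty
    sums in [exists_divergence_ge]. *)
Lemma exists_frechet_point (G : set X) (f : X -> Y) (N1 : set X) (x0 : X) :
  open G -> G x0 ->
  [set x | G x /\ ~ differentiable f x] `<=` N1 ->
  residual [set g : gamma_space X |
    product_lebesgue (gamma_fun g @^-1` N1) = 0%E] ->
  exists2 x, G x & differentiable f x.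
Proof.
move=> oG Gx0 dN1 r1.
have /nbhs_ballP[rho rho0 Grho] : nbhs x0 G by exact: open_nbhs_nbhs.
have [Cg0 _] := affine_surface_C1 (fun i : 'I_0 => 0 : X) x0 1.
pose g0 : gamma_space X :=
  exist _ (affine_surface (fun i : 'I_0 => 0) x0 1) (mem_set Cg0).
have [g gg0 nullA] := generic_surface g0 0%N r1 r1 rho0.
have Ch := gamma_funP g; have [CB hB] := C1_surfaceB Ch Cg0.
have I0 (P : 'I_0 -> Prop) i : P i by case: i.
have lim0 t : (forall j, D (t j)) ->
    ~ (gamma_fun g @^-1` N1 `|` gamma_fun g @^-1` N1) (to_cube t) ->
    \sum_(i < 0) (a n)^-1 * (0 - 0 : R) @[n --> \oo] --> (0 : R).
  by move=> _ _; under eq_fun do rewrite big_ord0; exact: cvg_cst.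
have [t [_ nA _]] := @exists_divergence_ge _ _ 0%N (fun _ _ => 0) (fun=> 0)
  (fun _ _ => 0) (fun=> 0) (fun=> 0) 1 nullA (fun _ _ => lexx 0)
  (I0 _) (I0 _) (I0 _) lim0 ltr01.
have Gx : G (gamma_fun g (to_cube t)).
  apply: Grho; rewrite -ball_normE /= distrC.
  apply: le_lt_trans (gg0 0%N isT); rewrite /gamma_dist.
  have := @le_gamma_seminorm _ _ 0%N _ (to_cube t) CB.
  by rewrite hB /= /affine_surface /centered_sum big_ord0 scaler0 addr0.
exists (gamma_fun g (to_cube t)) => //.
by apply: contrapT => nd; apply: nA; left; apply: dN1.
Qed.

Variables (m : nat) (v : 'I_m -> X) (ystar : 'I_m -> {linear Y -> R^o}).
Hypothesis ystar_continuous : forall i, continuous (ystar i).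

Lemma exists_frechet_pairing_gt (G : set X) (f : X -> Y) (N1 N2 : set X)
    (k : R) (x0 : X) (L : {linear X -> Y}) (delta : R) :
  open G -> G x0 -> 0 < k ->
  (forall x y, G x -> G y -> `|f x - f y| <= k * `|x - y|) ->
  [set x | G x /\ ~ differentiable f x] `<=` N1 ->
  residual [set g : gamma_space X |
    product_lebesgue (gamma_fun g @^-1` N1) = 0%E] ->
  residual [set g : gamma_space X |
    product_lebesgue (gamma_fun g @^-1` N2) = 0%E] ->
  is_gateaux_derivative f x0 L -> 0 < delta ->
  exists x, [/\ G x, differentiable f x, ~ N2 x &
    \sum_(i < m) (ystar i (L (v i)) : R) - delta <
    \sum_(i < m) (ystar i ('d f x (v i)) : R)].
Proof.
move=> oG Gx0 k0 fk dN1 r1 r2 gL de0.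
have [C CP] := linear_norm_bounds ystar_continuous.
have C0 i : 0 <= C i := (CP i).1.
pose Cs := \sum_(i < m) C i + 1.
have Cs0 : 0 < Cs by rewrite ltr_wpDl// sumr_ge0.
have sC (x : R) : 0 <= x -> \sum_(i < m) C i * x <= Cs * x.
  by move=> x0'; rewrite -mulr_suml; apply: ler_wpM2r => //; rewrite lerDl.
have /nbhs_ballP[rho rho0 Grho] : nbhs x0 G by exact: open_nbhs_nbhs.
have {}Grho x : `|x - x0| < rho -> G x.
  by move=> xx0; apply: Grho; rewrite -ball_normE /= distrC.
(* One half of [rho] is reserved for the affine surface, the other for its perturbation. *)
have rho2 : 0 < rho / 2 by rewrite divr_gt0.
have Grho2 x : `|x - x0| < rho / 2 -> G x by move=> ?; apply: Grho; lra.
(* Error budget in units of [r * delta / 8]: three for the sums with [k * eta], two for those with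
   [eps * r], one for the choice of the point. These six units stay below [r * delta]. *)
pose eps := delta / 8 / Cs; have eps0 : 0 < eps by rewrite !divr_gt0.
have [r r0 rP] := gateaux_uniform v k0 fk rho2 Grho2 gL eps0.
pose eta := Num.min (rho / 2) (r * delta / 8 / Cs / k).
have eta0 : 0 < eta by rewrite lt_min rho2 !divr_gt0// mulr_gt0.
pose g0f := affine_surface v x0 r.
have [Cg0 dg0] := affine_surface_C1 v x0 r.
pose g0 : gamma_space X := exist _ g0f (mem_set Cg0).
(* By the shift of indices, the seminorms up to [m] control the surface and its partial derivatives
   in the coordinates below [m]. *)
have [g gg0 nullA] := generic_surface g0 m r1 r2 eta0.
pose h := gamma_fun g; have Ch : C1_surface h := gamma_funP g.
have [_ hB] := C1_surfaceB Ch Cg0.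
have hd p t : (p <= m)%N ->
    `|gamma_derive p h t - gamma_derive p g0f t| <= eta.
  move=> pm; rewrite -hB; apply: le_trans (ltW (gg0 p pm)).
  by apply: le_gamma_seminorm; have [] := C1_surfaceB Ch Cg0.
have eta_rho : eta <= rho / 2 by rewrite ge_min lexx.
have hx0 t : `|h t - x0| < rho.
  rewrite -[h t](subrK (g0f t)) -addrA (le_lt_trans (ler_normD _ _))//.
  have := hd 0%N t isT; have [] := rP t; rewrite /= -/g0f; lra.
have Gh t : G (h t) by exact: Grho.
pose gi i (t : nat -> R) : R := ystar i (f (h (to_cube t))).
have rgi i := regular_functional_surface k0 fk Gx0 (C0 i) (CP i).2 Ch
  (fun t => conj (Gh t) (ltW (hx0 t))).
have K0 i j : 0 <= C i * (k * gamma_seminorm j.+1 h).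
  by rewrite !mulr_ge0 ?C0 ?(ltW k0)//; exact: gamma_seminorm_ge0.
(* Between opposite faces the centered sum changes by [v i]; each of the two faces contributes an
   error [k * eta + eps * r]. *)
pose b i := r * (ystar i (L (v i)) : R) - C i * (2 * (k * eta + eps * r)).
pose S (t : nat -> R) : R :=
  \sum_(i < m) (ystar i
    ('d f (h (to_cube t)) (partial_derive i h (to_cube t))) : R).
have dfh t : ~ N1 (h t) -> differentiable f (h t).
  by move=> nN; apply: contrapT => nd; apply: nN; apply: dN1.
have e0 : 0 < r * delta / 8 by rewrite divr_gt0// mulr_gt0.
have gi1 i t s : 1 <= s -> gi i (update t i s) = gi i (update t i 1).
  move=> s1; rewrite /gi; congr (ystar i (f (h _))).
  apply/funext => j; apply: val_inj; rewrite /to_cube !val_to_unit /update.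
  by case: eqP => // _; rewrite !clamp_ge1.
have gib i t : b i <= gi i (update t i 1) - gi i (update t i 0).
  set T1 := to_cube (update t i 1); set T0 := to_cube (update t i 0).
  have approx T :
      `|f (h T) - f x0 - r *: L (centered_sum v T)| <= k * eta + eps * r.
    have [_ hT] := rP T; have hTd := hd 0%N T isT.
    rewrite (_ : _ - _ = (f (h T) - f (g0f T)) +
      (f (g0f T) - f x0 - r *: L (centered_sum v T))); last first.
      by rewrite !addrA subrK.
    rewrite (le_trans (ler_normD _ _))// lerD//.
    have Gg0 : G (g0f T) by apply: Grho2; have [] := rP T.
    rewrite (le_trans (fk _ _ (Gh T) Gg0))//.
    by apply: ler_wpM2l; [exact: ltW|exact: hTd].
  have T10 : centered_sum v T1 = centered_sum v T0 + v i.
    apply/eqP; rewrite addrC -subr_eq; apply/eqP.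
    rewrite /T1 -(update_update t i 0 1) to_cube_update centered_sum_update.
    rewrite /to_cube update_same !val_to_unit direction_ord.
    rewrite !clamp_id ?subr0 ?scale1r//= in_itv/= ?lexx ler01//.
  have := le_trans ((CP i).2 _) (ler_wpM2l (C0 i) (approx T1)).
  have := le_trans ((CP i).2 _) (ler_wpM2l (C0 i) (approx T0)).
  rewrite T10 !linearD/= ?linearN/= ?linearZ/= ?linearD/= !ler_norml /b /gi -/T1 -/T0.
  rewrite /GRing.scale/=.
  move=> /andP[p1 p2] /andP[p3 p4]; move: p1 p2 p3 p4.
  rewrite !mulrDr; lra.
have giS t : (forall j, D (t j)) ->
    ~ (h @^-1` N1 `|` h @^-1` N2) (to_cube t) ->
    \sum_(i < m) (a n)^-1 * (gi i (update t i (t i + a n)) - gi i t)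
      @[n --> \oo] --> S t.
  move=> tD nA.
  rewrite /S; apply: cvg_big => [|i _]; first exact: add_continuous.
  have nN1 : ~ N1 (h (to_cube t)) by move=> ?; apply: nA; left.
  have := surface_increment_cvg Ch (tD i).
  have a0 n : 0 < a n by rewrite /harmonic invr_gt0.
  move=> /(differentiable_path_cvg (dfh _ nN1) a0 (@cvg_harmonic R)) wc.
  have := cvg_comp _ _ wc (@ystar_continuous i _).
  apply: cvg_trans; apply: near_eq_cvg; apply: nearW => n /=.
  rewrite linearZ /= linearB /= /gi.
  by rewrite (addrC (h (to_cube t))) subrK.
have [t [tD nA tS]] := exists_divergence_ge nullA K0 rgi gi1 gib giS e0.
have nN1 : ~ N1 (h (to_cube t)) by move=> ?; apply: nA; left.
have nN2 : ~ N2 (h (to_cube t)) by move=> ?; apply: nA; right.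
exists (h (to_cube t)); split => //; first exact: dfh.
set x := h (to_cube t).
have gd := differentiable_gateaux (dfh _ nN1).
(* The partial derivatives of [h] are within [eta] of [r *: v i], and the derivative of [f] at a
   point of [G] has norm at most [k]. *)
have Sle : S t <=
    \sum_(i < m) (r * (ystar i ('d f x (v i)) : R) + C i * (k * eta)).
  apply: ler_sum => i _; rewrite -/x.
  set p := partial_derive i h (to_cube t).
  have pv : `|p - r *: v i| <= eta.
    have := hd i.+1 (to_cube t) (ltn_ord i).
    by rewrite /= /g0f dg0 direction_ord.
  have dfp : `|'d f x (p - r *: v i)| <= k * eta.
    rewrite (le_trans (is_derive_norm_le oG (Gh _) fk (gd.2 _)))//.
    by apply: ler_wpM2l => //; exact: ltW.
  have := le_trans ((CP i).2 _) (ler_wpM2l (C0 i) dfp).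
  rewrite !linearB !linearZ /= ler_norml => /andP[_].
  by rewrite /GRing.scale/= => ?; lra.
have keta : Cs * (k * eta) <= r * delta / 8.
  have : eta <= r * delta / 8 / Cs / k by rewrite ge_min lexx orbT.
  by rewrite ler_pdivlMr// ler_pdivlMr// mulrC (mulrC k).
have epsr : Cs * (eps * r) = r * delta / 8.
  by rewrite /eps mulrA mulrC [Cs * _]mulrC divfK ?gt_eqF// mulrA.
have ke0 : 0 <= k * eta by rewrite mulr_ge0// ltW.
have er0 : 0 <= eps * r by rewrite mulr_ge0// ltW.
have s1 := sC _ ke0; have s2 := sC _ er0.
move: (le_trans tS Sle); rewrite /b sumrB big_split/= -!mulr_sumr.
rewrite (_ : \sum_(i < m) C i * (2 * (k * eta + eps * r)) =
  2 * (\sum_(i < m) C i * (k * eta)) +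
  2 * (\sum_(i < m) C i * (eps * r))); last first.
  by rewrite !mulr_sumr -big_split/=; apply: eq_bigr => i _; ring.
move: s1 s2; rewrite epsr.
set c1 := \sum_(i < m) C i * (k * eta); set c2 := \sum_(i < m) C i * (eps * r).
set p1 := \sum_(i < m) _; set p2 := \sum_(i < m) _ => s1 s2 main.
rewrite -(ltr_pM2l r0) mulrBr.
have rd : 0 < r * delta by exact: mulr_gt0.
lra.
Qed.

End slice_points.

Theorem theorem5p2 (R : realType) (X Y : completeNormedModType R)
    (G : set X) (G_open : open G) (G_nonempty : G !=set0)
    (f : X -> Y) (f_lipschitz : [lipschitz f x | x in G])
    (f_frechet_ae : gamma_null [set x | G x /\ ~ differentiable f x])
    (m : nat) (v : 'I_m -> X) (ystar : 'I_m -> {linear Y -> R^o})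
    (ystar_continuous : forall i, continuous (ystar i))
    (delta : R) (delta_gt0 : 0 < delta) :
  ~ gamma_null [set x | [/\ G x, differentiable f x &
      slice (gateaux_derivatives G f) v ystar delta ('d f x)]].
Proof.
move=> [N2 [_ rN2] sN2].
have [N1 [_ rN1] sN1] := f_frechet_ae.
have [x0 Gx0] := G_nonempty.
have [k k0 fk] := lipschitz_const f_lipschitz.
pose pairing (L : {linear X -> Y}) : R := \sum_(i < m) (ystar i (L (v i)) : R).
pose V := [set pairing L | L in gateaux_derivatives G f].
(* Bounded because every Gateaux derivative of a [k]-Lipschitz map on the open set [G] has norm at
   most [k]. *)
have supV : has_sup V.
  split.
    have [x Gx dx] := exists_frechet_point G_open Gx0 sN1 rN1.
    exists (pairing ('d f x)), ('d f x) => //; exists x => //.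
    exact: differentiable_gateaux.
  have [C CP] := linear_norm_bounds ystar_continuous.
  exists (\sum_(i < m) C i * (k * `|v i|)) => _ [L [x Gx [_ dL]] <-].
  apply: ler_sum => i _; rewrite (le_trans (ler_norm _))//.
  rewrite (le_trans ((CP i).2 _))//; apply: ler_wpM2l; first exact: (CP i).1.
  exact: is_derive_norm_le G_open Gx fk (dL _).
have d2 : 0 < delta / 2 by rewrite divr_gt0.
(* Half of [delta] is spent on approaching the supremum, half on passing from [L] to a Frechet
   derivative off [N2]. *)
have [_ [L [x Gx gL] <-] Lsup] := sup_adherent d2 supV.
have [z [Gz dz nN2 zL]] := exists_frechet_pairing_gt v ystar_continuous
  G_open Gx k0 fk sN1 rN1 rN2 gL d2.
apply: nN2; apply: sN2; split => //; split.
  by exists z => //; exact: differentiable_gateaux.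
by move: Lsup zL; rewrite /= -/V /pairing /V /pairing; lra.
Qed.
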